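(* Let $n\in\mathbb N$, let $A$ be an $n\times n$ real matrix all of whose (complex) eigenvalues have positive real parts, and let $G:\mathbb R^n\to\mathbb R^n$, $G\sim\sum_{m\ge2}G_m$, $G_m(x)=\mathcal G_m(x,\dots,x)$, be as in the context. Let $f:(0,\infty)\to\mathbb R^n$ be a function that is continuous on $[T_f,\infty)$ for some $T_f\ge 0$. Let $T_0\ge0$ and let $y\in C^1((T_0,\infty),\mathbb R^n)$ be a solution of $y'=-Ay+G(y)+f(t)$ on $(T_0,\infty)$ with $y(t)\to0$ as $t\to\infty$. Let $(\mu_k)_{k=1}^\infty$ be a divergent, strictly increasing sequence of positive numbers and $\mathcal S=\{\mu_k:k\in\mathbb N\}$. (i) Suppose $x+x'\in\mathcal S$ and $x+1\in\mathcal S$ for all $x,x'\in\mathcal S$, and let $(n_k)_{k=1}^\infty$ be an increasing sequence in $\mathbb Z_+$ (meaning $n_k\le n_{k+1}$). Assume that $f$ admits the asymptotic expansion, in the $L_0$-sense of the context, $f(t)\sim\sum_{k=1}^\infty f_k(t)$ with $f_k\in\mathscr F_0(n_k,-\mu_k,\mathbb C^n,\mathbb R^n)$ for $k\in\mathbb N$. Then there exist functions $y_k\in\mathscr F_0(n_k,-\mu_k,\mathbb C^n,\mathbb R^n)$, $k\in\mathbb N$, such that $y(t)\sim\sum_{k=1}^\infty y_k(t)$ in the $L_0$-sense. More specifically, assume that for all $k\in\mathbb N$, $f_k(t)=p_k(\widehat{\mathcal L}_{n_k}(t))$ with $p_k\in\mathscr P_0(n_k,-\mu_k,\mathbb C^n,\mathbb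 R^n)$. Then the $y_k$ can be constructed recursively by $y_k(t)=q_k(\widehat{\mathcal L}_{n_k}(t))$, where $$q_k=\mathcal Z_A\Big(\sum_{m\ge2}\ \sum_{\mu_{j_1}+\cdots+\mu_{j_m}=\mu_k}\mathcal G_m(q_{j_1},\ldots,q_{j_m})+p_k-\chi_k\Big),$$ with $\chi_k=\mathcal Rq_\lambda$ if there exists $\lambda\le k-1$ such that $\mu_\lambda+1=\mu_k$, and $\chi_k=0$ otherwise. (ii) Let $m_*\in\mathbb N$, suppose $x+x'\in\mathcal S$ for all $x,x'\in\mathcal S$, and let $(n_k)_{k=1}^\infty$ be an increasing sequence in $\mathbb N\cap[m_*,\infty)$ (meaning $n_k\le n_{k+1}$). Assume that $f$ admits the asymptotic expansion, in the $L_{m_*}$-sense of the context, $f(t)\sim\sum_{k=1}^\infty f_k(t)$ with $f_k\in\mathscr F_{m_*}(n_k,-\mu_k,\mathbb C^n,\mathbb R^n)$ for $k\in\mathbb N$. Then there exist functions $y_k\in\mathscr F_{m_*}(n_k,-\mu_k,\mathbb C^n,\mathbb R^n)$, $k\in\mathbb N$, such that $y(t)\sim\sum_{k=1}^\infty y_k(t)$ in the $L_{m_*}$-sense. More specifically, suppose that $f_k(t)=p_k(\widehat{\mathcal L}_{n_k}(t))$ with $p_k\in\mathscr P_{m_*}(n_k,-\mu_k,\mathbb C^n,\mathbb R^n)$ for all $k\in\mathbb N$. Then the $y_k$ can be constructed recursively by $y_k(t)=q_k(\widehat{\mathcal L}_{n_k}(t))$, where $$q_k=\mathcal Z_A\Big(\sum_{m\ge2}\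 \sum_{\mu_{j_1}+\cdots+\mu_{j_m}=\mu_k}\mathcal G_m(q_{j_1},\ldots,q_{j_m})+p_k\Big).$$
   Context: $\mathbb N=\{1,2,\dots\}$, $\mathbb Z_+=\mathbb N\cup\{0\}$; $|\cdot|$ is the Euclidean norm; $u(t)=\mathcal O(h(t))$ means that there are $T,C>0$ with $|u(t)|\le Ch(t)$ for all $t\ge T$. Assumption on $G$: $G:\mathbb R^n\to\mathbb R^n$ is locally Lipschitz, and there exist functions $G_m:\mathbb R^n\to\mathbb R^n$, $m\ge 2$, each a homogeneous polynomial of degree $m$, such that for any $N\ge2$ there exists $\delta>0$ with $|G(x)-\sum_{m=2}^N G_m(x)|=\mathcal O(|x|^{N+\delta})$ as $x\to0$. For each $m\ge2$, $\mathcal G_m$ is an $m$-linear mapping from $(\mathbb R^n)^m$ to $\mathbb R^n$ with $G_m(x)=\mathcal G_m(x,x,\ldots,x)$. Iterated functions: $E_0(t)=t$, $E_{m+1}(t)=e^{E_m(t)}$; $L_{-1}(t)=e^t$, $L_0(t)=t$, $L_{m+1}(t)=\ln L_m(t)$ for $m\in\mathbb Z_+$, $t>E_m(0)$. For $k\in\mathbb Z_+$, $\widehat{\mathcal L}_k(t)=(L_{-1}(t),L_0(t),L_1(t),\ldots,L_k(t))=(e^t,t,\ln t,\ldots,L_k(t))$, which lies in $(0,\infty)^{k+2}$ for $t>E_k(0)$. Power functions: for $t>0$, $c\in\mathbb C$, $t^c=\exp(c\ln t)$. For $z=(z_{-1},z_0,\ldots,z_k)\in(0,\infty)^{k+2}$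 and $\alpha=(\alpha_{-1},\alpha_0,\ldots,\alpha_k)\in\mathbb C^{k+2}$, $z^\alpha=\prod_{j=-1}^kz_j^{\alpha_j}$. Classes: for integers $k\ge m\ge-1$ and $\mu\in\mathbb R$, $\mathcal E(m,k,\mu)$ is the set of $\alpha\in\mathbb C^{k+2}$ with $\operatorname{Re}\alpha_j=0$ for $-1\le j<m$ and $\operatorname{Re}\alpha_m=\mu$. $\mathscr P(k,\mathbb C^n,\mathbb R^n)$ is the set of functions $p(z)=\sum_{\alpha\in S}z^\alpha\xi_\alpha$, $z\in(0,\infty)^{k+2}$, where $S$ is a finite subset of $\mathbb C^{k+2}$ closed under (componentwise) complex conjugation, $\xi_\alpha\in\mathbb C^n$, and $\xi_{\bar\alpha}=\overline{\xi_\alpha}$ for all $\alpha\in S$ (such functions are $\mathbb R^n$-valued). $\mathscr P_m(k,\mu,\mathbb C^n,\mathbb R^n)$ is the set of such functions with, in addition, $S\subset\mathcal E(m,k,\mu)$; and $\mathscr F_m(k,\mu,\mathbb C^n,\mathbb R^n)=\{p\circ\widehat{\mathcal L}_k:p\in\mathscr P_m(k,\mu,\mathbb C^n,\mathbb R^n)\}$. For $k<k'$, such a function of $z\in(0,\infty)^{k+2}$ is regarded as a function of $z\in(0,\infty)^{k'+2}$ not depending on the extra variables (zero exponents). Operators: for $p(z)=\sum_{\alpha\in S}z^\alpha\xi_\alpha$ ($S\subset\mathbb C^{k+2}$ finite, $\xi_\alpha\in\mathbb C^n$), $(\mathcal M_jp)(z)=\sum_{\alpha\in S}\alpha_jz^\alpha\xi_\alpha$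 for $-1\le j\le k$; for $k\ge0$, $(\mathcal Rp)(z)=\sum_{j=0}^kz_0^{-1}z_1^{-1}\cdots z_j^{-1}(\mathcal M_jp)(z)$; and, if $\operatorname{Re}\alpha_{-1}=0$ for all $\alpha\in S$, $(\mathcal Z_Ap)(z)=\sum_{\alpha\in S}z^\alpha(A+\alpha_{-1}I_n)^{-1}\xi_\alpha$ (the inverses exist by the spectral assumption on $A$). Asymptotic expansion ($L_{m_*}$-sense, $m_*\in\mathbb Z_+$): for $g:(T,\infty)\to\mathbb R^n$, a divergent, strictly increasing sequence $(\gamma_k)$ of positive numbers and integers $n_k\ge m_*$, $g(t)\sim\sum_{k=1}^\infty g_k(t)$ with $g_k\in\mathscr F_{m_*}(n_k,-\gamma_k,\mathbb C^n,\mathbb R^n)$ means: for each $N\in\mathbb N$ there is $\mu>\gamma_N$ with $|g(t)-\sum_{k=1}^Ng_k(t)|=\mathcal O(L_{m_*}(t)^{-\mu})$. In the double sums, $m$ ranges over integers $\ge2$ and $j_1,\ldots,j_m$ over $\mathbb N$ subject to the stated condition; the sum is finite, involves only indices $j_\ell\le k-1$, and is zero if no such indices exist. The index $\lambda$ in (i) is a positive integer, unique if it exists. *)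

(* Defs.v *)
From HB Require Import structures.
From mathcomp Require Import all_boot all_order all_algebra finmap.
From mathcomp Require Import all_classical all_reals all_analysis.
From mathcomp Require Import complex.
Set Implicit Arguments.
Unset Strict Implicit.
Unset Printing Implicit Defensive.
Import Order.TTheory GRing.Theory Num.Theory.
Import numFieldNormedType.Exports.
Local Open Scope classical_set_scope.
Local Open Scope complex_scope.
Local Open Scope ring_scope.

(* Conventions.
   - R^n and C^n are the column vectors 'cV[R]_n and 'cV[R[i]]_n.  The library
     norm on matrices is the sup norm, so the Euclidean norm is [enorm].
   - Sequences indexed by {1, 2, ...} are indexed from 0.
   - A point z = (z_{-1}, z_0, ..., z_k), or an exponent
     (alpha_{-1}, ..., alpha_k), is a row vector of length k.+2: the entry of
     index j is stored at position j + 1.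
   - Functions on (0, oo)^(k+2) are total functions whose values matter only on
     [posz]; likewise a function of t built on L_k matters only for t > E_k(0). *)

Section Defs.
Variable R : realType.

Definition enorm (n : nat) (x : 'cV[R]_n) : R :=
  Num.sqrt (\sum_i x i ord0 ^+ 2).

Definition cplx (m n : nat) (x : 'M[R]_(m, n)) : 'M[R[i]]_(m, n) :=
  map_mx (real_complex R) x.

Definition bigO_at_infty (n : nat) (u : R -> 'cV[R]_n) (h : R -> R) : Prop :=
  exists T C : R, [/\ 0 < T, 0 < C &
    forall t, T <= t -> enorm (u t) <= C * h t].

(** * The nonlinearity *)

Definition locally_lipschitz (n : nat) (G : 'cV[R]_n -> 'cV[R]_n) : Prop :=
  forall x, exists r L : R, 0 < r /\
    forall u v, enorm (u - x) < r -> enorm (v - x) < r ->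
      enorm (G u - G v) <= L * enorm (u - v).

(* Monomials of degree m are given by a : 'I_n -> {0, ..., m} of total m. *)
Definition homogeneous_polynomial (n m : nat) (P : 'cV[R]_n -> 'cV[R]_n) : Prop :=
  exists c : {ffun 'I_n -> 'I_m.+1} -> 'cV[R]_n, forall x,
    P x = \sum_(a : {ffun 'I_n -> 'I_m.+1} | (\sum_i a i == m)%N)
            (\prod_i x i ord0 ^+ a i) *: c a.

Definition multilinear_map (n m : nat)
    (g : ('I_m -> 'cV[R]_n) -> 'cV[R]_n) : Prop :=
  forall (v : 'I_m -> 'cV[R]_n) (i : 'I_m) (a : R) (x y : 'cV[R]_n),
    let subst w := fun j => if j == i then w else v j in
    g (subst (a *: x + y)) = a *: g (subst x) + g (subst y).

Definition homogeneous_expansion (n : nat) (G : 'cV[R]_n -> 'cV[R]_n)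
    (Gm : nat -> 'cV[R]_n -> 'cV[R]_n) : Prop :=
  (forall m, (2 <= m)%N -> homogeneous_polynomial m (Gm m)) /\
  forall N, (2 <= N)%N -> exists2 delta : R, 0 < delta &
    exists r C : R, [/\ 0 < r, 0 < C &
      forall x, enorm x < r ->
        enorm (G x - \sum_(2 <= m < N.+1) Gm m x)
          <= C * enorm x `^ (N%:R + delta)].

(** * Iterated exponentials and logarithms *)

Definition iterexp (m : nat) (t : R) : R := iter m (@expR R) t.
Definition iterlog (m : nat) (t : R) : R := iter m (@ln R) t.

(* (e^t, t, ln t, ..., L_k(t)) *)
Definition Lhat (k : nat) (t : R) : 'rV[R]_k.+2 :=
  \row_i (if (i : nat) is j.+1 then iterlog j t else expR t).

(** * Power functions *)

Definition cexp (c : R[i]) : R[i] :=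
  (expR (complex.Re c))%:C * (cos (complex.Im c) +i* sin (complex.Im c)).

Definition cpow (t : R) (c : R[i]) : R[i] := cexp (c * (ln t)%:C).

Definition zpow (k : nat) (z : 'rV[R]_k.+2) (a : 'rV[R[i]]_k.+2) : R[i] :=
  \prod_i cpow (z ord0 i) (a ord0 i).

Definition posz (k : nat) (z : 'rV[R]_k.+2) : Prop :=
  forall i, 0 < z ord0 i.

Definition gpoly (n k : nat) (S : {fset 'rV[R[i]]_k.+2})
    (xi : 'rV[R[i]]_k.+2 -> 'cV[R[i]]_n) (z : 'rV[R]_k.+2) : 'cV[R[i]]_n :=
  \sum_(a <- S) zpow z a *: xi a.

(* A function of (z_{-1}, ..., z_j) is regarded as a function of
   (z_{-1}, ..., z_k), j <= k, by composition with this truncation. *)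
Definition ztrunc (j k : nat) (z : 'rV[R]_k.+2) : 'rV[R]_j.+2 :=
  \row_i z ord0 (inord i).

(** * Classes of functions *)

(* E(m, k, mu), for 0 <= m <= k *)
Definition expo_class (m k : nat) (mu : R) (a : 'rV[R[i]]_k.+2) : Prop :=
  forall i : 'I_k.+2,
    ((i < m.+1)%N -> complex.Re (a ord0 i) = 0) /\
    (i = m.+1 :> nat -> complex.Re (a ord0 i) = mu).

(* P_m(k, mu, C^n, R^n) *)
Definition P_class (n m k : nat) (mu : R)
    (p : 'rV[R]_k.+2 -> 'cV[R]_n) : Prop :=
  exists (S : {fset 'rV[R[i]]_k.+2}) (xi : 'rV[R[i]]_k.+2 -> 'cV[R[i]]_n),
    [/\ forall a, a \in S -> map_mx conjc a \in S,
        forall a, a \in S -> xi (map_mx conjc a) = map_mx conjc (xi a),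
        forall a, a \in S -> expo_class m mu a &
        forall z, posz z -> cplx (p z) = gpoly S xi z].

(* F_m(k, mu, C^n, R^n) *)
Definition F_class (n m k : nat) (mu : R) (g : R -> 'cV[R]_n) : Prop :=
  exists2 p : 'rV[R]_k.+2 -> 'cV[R]_n, P_class m mu p &
    forall t, iterexp k 0 < t -> g t = p (Lhat k t).

Definition asymptotic_expansion (n m : nat) (gam : nat -> R) (nn : nat -> nat)
    (gk : nat -> R -> 'cV[R]_n) (g : R -> 'cV[R]_n) : Prop :=
  (forall k, F_class m (nn k) (- gam k) (gk k)) /\
  forall N, exists2 mu, gam N < mu &
    bigO_at_infty (fun t => g t - \sum_(k < N.+1) gk k t)
                  (fun t => iterlog m t `^ (- mu)).

(** * Operators *)

(* The operators R and Z_A are defined through a representation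
   p = sum_(a in S) z^a xi_a.  Distinct power functions z^a are linearly
   independent on (0, oo)^(k+2), so the representation of p is unique up to zero
   coefficients, and the relations [is_calR], [is_calZ] are graphs of
   (partial) functions. *)

Definition calM (n k : nat) (j : 'I_k.+2) (S : {fset 'rV[R[i]]_k.+2})
    (xi : 'rV[R[i]]_k.+2 -> 'cV[R[i]]_n) : 'rV[R]_k.+2 -> 'cV[R[i]]_n :=
  gpoly S (fun a => a ord0 j *: xi a).

(* [lift ord0 j] is the position of the entry of index j >= 0. *)
Definition calR (n k : nat) (S : {fset 'rV[R[i]]_k.+2})
    (xi : 'rV[R[i]]_k.+2 -> 'cV[R[i]]_n) (z : 'rV[R]_k.+2) : 'cV[R[i]]_n :=
  \sum_(j < k.+1)
    (\prod_(l < k.+1 | (l <= j)%N) (z ord0 (lift ord0 l))^-1)%:C *: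
      calM (lift ord0 j) S xi z.

Definition calZ (n k : nat) (A : 'M[R]_n) (S : {fset 'rV[R[i]]_k.+2})
    (xi : 'rV[R[i]]_k.+2 -> 'cV[R[i]]_n) : 'rV[R]_k.+2 -> 'cV[R[i]]_n :=
  gpoly S (fun a => invmx (cplx A + (a ord0 ord0)%:M) *m xi a).

Definition is_calR (n k : nat) (p r : 'rV[R]_k.+2 -> 'cV[R[i]]_n) : Prop :=
  exists (S : {fset 'rV[R[i]]_k.+2}) (xi : 'rV[R[i]]_k.+2 -> 'cV[R[i]]_n),
    (forall z, posz z -> p z = gpoly S xi z) /\
    (forall z, posz z -> r z = calR S xi z).

Definition is_calZ (n k : nat) (A : 'M[R]_n)
    (p r : 'rV[R]_k.+2 -> 'cV[R[i]]_n) : Prop :=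
  exists (S : {fset 'rV[R[i]]_k.+2}) (xi : 'rV[R[i]]_k.+2 -> 'cV[R[i]]_n),
    [/\ forall a, a \in S -> complex.Re (a ord0 ord0) = 0,
        forall z, posz z -> p z = gpoly S xi z &
        forall z, posz z -> r z = calZ A S xi z].

(** * Right-hand sides of the recursions *)

(* The sums run over the nonzero terms; the index sets of the inner sums are
   finite, and empty for large m, when mu > 0 increases to infinity. *)
Definition nonlinear_sum (n : nat) (mu : nat -> R) (nn : nat -> nat)
    (calG : forall m, ('I_m -> 'cV[R]_n) -> 'cV[R]_n)
    (q : forall k, 'rV[R]_(nn k).+2 -> 'cV[R]_n)
    (k : nat) (z : 'rV[R]_(nn k).+2) : 'cV[R]_n :=
  \sum_(m \in [set m : nat | (2 <= m)%N])
    \sum_(j \in [set j : {ffun 'I_m -> nat} | \sum_l mu (j l) = mu k])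
      calG m (fun l => q (j l) (ztrunc (nn (j l)) z)).

Definition is_chi (n : nat) (mu : nat -> R) (nn : nat -> nat)
    (q : forall k, 'rV[R]_(nn k).+2 -> 'cV[R]_n)
    (k : nat) (chi : 'rV[R]_(nn k).+2 -> 'cV[R[i]]_n) : Prop :=
  (forall l, (l < k)%N -> mu l + 1 = mu k ->
     exists2 r : 'rV[R]_(nn l).+2 -> 'cV[R[i]]_n,
       is_calR (fun z => cplx (q l z)) r &
       forall z, posz z -> chi z = r (ztrunc (nn l) z)) /\
  ((forall l, (l < k)%N -> mu l + 1 <> mu k) ->
     forall z, posz z -> chi z = 0).

End Defs.

(* Main.v *)
Require Import Defs.
From HB Require Import structures.
From mathcomp Require Import all_boot all_order all_algebra finmap.
From mathcomp Require Import all_classical all_reals all_analysis.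
From mathcomp Require Import complex spectral mxred ring lra.
Import Order.TTheory GRing.Theory Num.Theory.
Import numFieldNormedType.Exports.
Set Implicit Arguments.
Unset Strict Implicit.
Unset Printing Implicit Defensive.
Local Open Scope classical_set_scope.
Local Open Scope ring_scope.

(* Along z = Lhat_k(t) one has z^a = exp(sum_j a_j L_(j+1)(t)), so that
   d/dt p(Lhat_k(t)) = (M_(-1) p + R p)(Lhat_k(t)), and q = Z_A g solves
   (A + M_(-1)) q = g.  Hence u_N = q_1 + ... + q_N satisfies the differential
   equation up to an error O(L_m^(-beta)) for any beta close enough to mu_N from
   above.  The remainder w = y - u_N is estimated directly, without induction on N:
   it tends to 0 and w' = - A w + h with |h| <= eta |w| + K L_m^(-beta), where eta
   is as small as one likes.  Indeed, expanding G_m(y) with y = u_N + w by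
   multilinearity, every term either occurs in the recursion for some q_k with
   k <= N, or is O(L_m^(-beta)), or contains w together with another small factor.
   A quadratic Lyapunov function V for - A then gives V(w) <= K L_m^(-2 beta),
   because L_m^(-beta) varies slowly. *)

(** * Lyapunov functions and perturbed linear equations *)

Section MatrixNorm.
Variable R : realType.

(** The only a priori information on y is that it tends to 0; no decay rate is known. Error terms
    are therefore measured as o(|w|) + O(L_m^(-beta)): the first part is absorbed by the dissipation
    of the linear equation, so the nonlinearity can be expanded before any rate for w is available.
    The window mu_N < beta < mu_(N+1) works because sums of the mu_k are again values of mu: a sum
    exceeding mu_N is at least mu_(N+1) and leaves a gap above beta. The gap pays for a loss: a
    power function with exponent in E(m, k, mu) is bounded by L_m^nu only for nu > mu, since the
    exponents of the slower logarithms are arbitrary. The two cases differ in the effect of the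
    factor 1/t carried by every term of R. For m = 0 it lowers the exponent by exactly one and
    produces the corrections chi_k; for m >= 1 it is smaller than every power of L_m and goes into
    the error. Coefficients are complex while y is real, so families of terms are symmetrised under
    conjugation whenever a real function has to be exhibited. *)

Lemma coord_le_norm (m n : nat) (x : 'M[R]_(m, n)) i j : `|x i j| <= `|x|.
Proof.
rewrite [leRHS]/Num.Def.normr/= mx_normrE.
exact: (le_bigmax _ (fun ij : 'I_m * 'I_n => `|x ij.1 ij.2|) (i, j)).
Qed.

Lemma norm_le_coord (m n : nat) (x : 'M[R]_(m, n)) (c : R) :
  0 <= c -> (forall i j, `|x i j| <= c) -> `|x| <= c.
Proof.
move=> c0 xc; rewrite [leLHS]/Num.Def.normr/= mx_normrE.
by apply: bigmax_le => // -[i j] _; exact: xc.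
Qed.

Lemma norm_mulmx_le (m n p : nat) (A : 'M[R]_(m, n)) (B : 'M[R]_(n, p)) :
  `|A *m B| <= n%:R * `|A| * `|B|.
Proof.
apply: norm_le_coord => [|i j]; first by rewrite !mulr_ge0.
rewrite mxE (le_trans (ler_norm_sum _ _ _))//.
apply: (@le_trans _ _ (\sum_(k < n) `|A| * `|B|)); last first.
  by rewrite sumr_const card_ord -mulrA mulr_natl.
apply: ler_sum => k _; rewrite normrM; apply: ler_pM => //; exact: coord_le_norm.
Qed.

Lemma sqr_norm_le_sum (n : nat) (x : 'cV[R]_n) :
  `|x| ^+ 2 <= \sum_i x i ord0 ^+ 2.
Proof.
have S0 : 0 <= \sum_i x i ord0 ^+ 2 by apply: sumr_ge0 => i _; exact: sqr_ge0.
rewrite -(sqr_sqrtr S0) ler_sqr ?nnegrE ?sqrtr_ge0//.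
apply: norm_le_coord => [|i j]; first exact: sqrtr_ge0.
rewrite -ler_sqr ?nnegrE ?sqrtr_ge0// sqr_sqrtr// real_normK ?num_real//.
rewrite (ord1 j) (bigD1 i)//= lerDl; apply: sumr_ge0 => k _; exact: sqr_ge0.
Qed.

Lemma norm_le_enorm (n : nat) (x : 'cV[R]_n) : `|x| <= enorm x.
Proof.
rewrite /enorm -ler_sqr ?nnegrE ?sqrtr_ge0// sqr_sqrtr ?sqr_norm_le_sum//.
by apply: sumr_ge0 => i _; exact: sqr_ge0.
Qed.

Lemma enorm_le_norm (n : nat) (x : 'cV[R]_n) : enorm x <= n%:R * `|x|.
Proof.
rewrite /enorm -[leRHS]ger0_norm ?mulr_ge0// -sqrtr_sqr; apply: ler_wsqrtr.
apply: (@le_trans _ _ (\sum_(i < n) `|x| ^+ 2)).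
  apply: ler_sum => i _; rewrite -(real_normK (num_real (x i ord0))).
  by rewrite ler_sqr ?nnegrE ?coord_le_norm.
rewrite sumr_const card_ord -[leLHS]mulr_natl exprMn ler_wpM2r ?sqr_ge0//.
by rewrite -natrX ler_nat; case: n {x} => // n; rewrite expnS expn1 leq_pmulr.
Qed.

End MatrixNorm.

Section Lyapunov.
Variable R : realType.
Local Notation C := R[i].
Local Notation Re := (@complex.Re R).
Local Notation Im := (@complex.Im R).

Definition nsq (c : C) : R := Re c ^+ 2 + Im c ^+ 2.

Lemma nsq_ge0 c : 0 <= nsq c.
Proof. by rewrite addr_ge0 ?sqr_ge0. Qed.

Lemma complex_ReM (a b : C) : Re (a * b) = Re a * Re b - Im a * Im b.
Proof. by case: a b => a1 a2 [b1 b2]. Qed.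

Lemma complex_ImM (a b : C) : Im (a * b) = Re a * Im b + Im a * Re b.
Proof. by case: a b => a1 a2 [b1 b2]. Qed.

Lemma complex_ReD (a b : C) : Re (a + b) = Re a + Re b.
Proof. by case: a b => a1 a2 [b1 b2]. Qed.

Lemma complex_ImD (a b : C) : Im (a + b) = Im a + Im b.
Proof. by case: a b => a1 a2 [b1 b2]. Qed.

Lemma complex_Re_sum (I : Type) (r : seq I) (P : pred I) (F : I -> C) :
  Re (\sum_(i <- r | P i) F i) = \sum_(i <- r | P i) Re (F i).
Proof. exact: (big_morph Re complex_ReD (erefl : Re (0 : C) = 0)). Qed.

Lemma complex_Im_sum (I : Type) (r : seq I) (P : pred I) (F : I -> C) :
  Im (\sum_(i <- r | P i) F i) = \sum_(i <- r | P i) Im (F i).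
Proof. exact: (big_morph Im complex_ImD (erefl : Im (0 : C) = 0)). Qed.

(** Controls one off-diagonal term of the Hermitian form in the Lyapunov estimate; [|Re t| + |Im t|]
    stands in for the modulus of t, and the constant is not optimised. *)
Lemma Re_conj_mulM_ge (K : R) (a t b : C) : `|Re t| + `|Im t| <= K ->
  - (K * (nsq a + nsq b)) <= Re (conjc a * (t * b)).
Proof.
case: a t b => a1 a2 [t1 t2] [b1 b2]; rewrite /nsq/= => tK.
have S2 : 0 <= a1 ^+ 2 + a2 ^+ 2 + (b1 ^+ 2 + b2 ^+ 2).
  by rewrite !addr_ge0 ?sqr_ge0.
have P1 : `|a1 * b1 + a2 * b2| <= a1 ^+ 2 + a2 ^+ 2 + (b1 ^+ 2 + b2 ^+ 2).
  have := sqr_ge0 (a1 - b1); have := sqr_ge0 (a1 + b1).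
  have := sqr_ge0 (a2 - b2); have := sqr_ge0 (a2 + b2).
  rewrite ler_norml; move=> *; apply/andP; split; lra.
have P2 : `|a2 * b1 - a1 * b2| <= a1 ^+ 2 + a2 ^+ 2 + (b1 ^+ 2 + b2 ^+ 2).
  have := sqr_ge0 (a2 - b1); have := sqr_ge0 (a2 + b1).
  have := sqr_ge0 (a1 - b2); have := sqr_ge0 (a1 + b2).
  rewrite ler_norml; move=> *; apply/andP; split; lra.
set S := _ + _ in S2 P1 P2 *.
have -> : a1 * (t1 * b1 - t2 * b2) - - a2 * (t1 * b2 + t2 * b1) =
  t1 * (a1 * b1 + a2 * b2) + t2 * (a2 * b1 - a1 * b2) by ring.
have Q1 : `|t1 * (a1 * b1 + a2 * b2)| <= `|t1| * S by rewrite normrM ler_wpM2l.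
have Q2 : `|t2 * (a2 * b1 - a1 * b2)| <= `|t2| * S by rewrite normrM ler_wpM2l.
have := ler_normD (t1 * (a1 * b1 + a2 * b2)) (t2 * (a2 * b1 - a1 * b2)).
move=> /le_trans/(_ (lerD Q1 Q2)); rewrite -mulrDl.
move=> /le_trans/(_ (ler_wpM2r S2 tK)).
by rewrite ler_norml => /andP[].
Qed.

Lemma eigenvalue_det (F : fieldType) (n : nat) (M : 'M[F]_n) (l : F) :
  \det (M - l%:M) = 0 -> eigenvalue M l.
Proof.
move=> d0; rewrite /eigenvalue /eigenspace kermx_eq0 row_free_unit.
by rewrite unitmxE d0 unitr0.
Qed.

Lemma det_trig_sub_diag (F : fieldType) (n : nat) (T : 'M[F]_n) (i : 'I_n) :
  is_trig_mx T -> \det (T - (T i i)%:M) = 0.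
Proof.
move=> Ttrig; rewrite det_trig; last first.
  apply/is_trig_mxP => j k jk; rewrite !mxE (is_trig_mxP Ttrig)//.
  by rewrite -val_eqE/= ltn_eqF// subr0.
by rewrite (bigD1 i)//= !mxE eqxx mulr1n subrr mul0r.
Qed.

(** P conjugates M - l into T - l, whose determinant vanishes because T is triangular with l on its
    diagonal. This transfers the spectral assumption to the diagonal of the Schur form. *)
Lemma Schur_diag_eigenvalue (n : nat) (M P : 'M[C]_n) (i : 'I_n) :
  P \in unitmx -> is_trig_mx (P *m M *m invmx P) ->
  eigenvalue M ((P *m M *m invmx P) i i).
Proof.
set T := P *m M *m invmx P => Pu Ttrig; apply: eigenvalue_det.
have := det_trig_sub_diag i Ttrig; set l := T i i => Tl0.
have E : P *m (M - l%:M) = (T - l%:M) *m P.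
  by rewrite mulmxBr mulmxBl mul_mx_scalar mul_scalar_mx /T mulmxKV.
have := congr1 determinant E; rewrite !det_mulmx Tl0 mul0r => /eqP.
rewrite mulf_eq0 .
by move: Pu; rewrite unitmxE unitfE => /negbTE -> /= /eqP.
Qed.

Lemma positive_lower_bound (n : nat) (F : 'I_n -> R) :
  (forall i, 0 < F i) -> exists2 a, 0 < a & forall i, a <= F i.
Proof.
move=> F0; exists (\big[Order.min/1]_i F i); last by move=> i; exact: bigmin_le_cond.
by apply: lt_bigmin => // i _; exact: F0.
Qed.

(* Conjugating the Schur form by diag(e^i) scales its (i, j) entry by e^(i - j),
   so that the off-diagonal part becomes negligible_wrt. *)
Lemma complex_lyapunov (n : nat) (M : 'M[C]_n) : (0 < n)%N ->
  (forall l, eigenvalue M l -> 0 < Re l) ->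
  exists P : 'M[C]_n, P \in unitmx /\ exists2 a : R, 0 < a &
    forall x : 'cV[C]_n,
      a * \sum_i nsq ((P *m x) i ord0) <=
      \sum_i Re (conjc ((P *m x) i ord0) * (P *m (M *m x)) i ord0).
Proof.
move=> n0 Mspec; have [P0 P0unitary] := Schur M n0.
have P0u : P0 \in unitmx by exact: unitarymx_unit.
rewrite /similar_to conjumx//; set T := P0 *m M *m invmx P0 => Ttrig.
have [a a0 aT] : exists2 a, 0 < a & forall i, a <= Re (T i i).
  apply: positive_lower_bound => i; apply: Mspec; exact: Schur_diag_eigenvalue.
(* A bound for all entries of T; the summand 1 keeps the denominator in [e] positive. *)
pose K : R := 1 + \sum_i \sum_j (`|Re (T i j)| + `|Im (T i j)|).
have TK i j : `|Re (T i j)| + `|Im (T i j)| <= K.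
  have ge0 k l : 0 <= `|Re (T k l)| + `|Im (T k l)| by rewrite addr_ge0.
  rewrite /K (bigD1 i)//= (bigD1 j)//=.
  have s1 : 0 <= \sum_(k < n | k != j) (`|Re (T i k)| + `|Im (T i k)|).
    by apply: sumr_ge0.
  have s2 : 0 <= \sum_(k < n | k != i) \sum_l (`|Re (T k l)| + `|Im (T k l)|).
    by apply: sumr_ge0 => k _; apply: sumr_ge0.
  lra.
have K1 : 1 <= K.
  by rewrite /K lerDl; apply: sumr_ge0 => i _; apply: sumr_ge0 => j _; rewrite addr_ge0.
have nK : 0 < 4 * n%:R * K by rewrite !mulr_gt0 ?ltr0n// (lt_le_trans _ K1).
(* The off-diagonal terms cost at most 2 n K e S, where S is the squared length of v; this choice
   makes the cost at most a S / 2, half of what the diagonal provides. *)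
pose e := Num.min 1 (a / (4 * n%:R * K)).
have e0 : 0 < e by rewrite lt_min ltr01 divr_gt0.
have e1 : e <= 1 by rewrite ge_min lexx.
have eK : 4 * n%:R * K * e <= a.
  by rewrite mulrC -ler_pdivlMr// ge_min lexx orbT.
pose ee : C := real_complex R e.
have ee0 : ee != 0 by rewrite eq_complex/= negb_and gt_eqF.
pose d : 'rV[C]_n := \row_i ee ^+ i.
have P0M x : P0 *m (M *m x) = T *m (P0 *m x).
  by rewrite /T !mulmxA mulmxKV.
exists (diag_mx d *m P0); split.
  rewrite unitmx_mul P0u andbT unitmxE det_diag unitfE.
  by apply/prodf_neq0 => i _; rewrite mxE expf_neq0.
exists (a / 2); first by rewrite divr_gt0.
move=> x; rewrite -!mulmxA P0M.
set u := P0 *m x; set v := diag_mx d *m u.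
have vE i : v i ord0 = ee ^+ i * u i ord0 by rewrite /v mul_diag_mx [LHS]mxE [d _ _]mxE.
pose w (i j : 'I_n) : C := if (j <= i)%N then real_complex R (e ^+ (i - j)) * T i j else 0.
have TvE i : (diag_mx d *m (T *m u)) i ord0 = \sum_j w i j * v j ord0.
  rewrite mul_diag_mx [LHS]mxE [d _ _]mxE [(T *m u) _ _]mxE mulr_sumr.
  apply: eq_bigr => j _; rewrite /w vE.
  case: leqP => ij; last by rewrite (is_trig_mxP Ttrig)// !(mul0r, mulr0).
  rewrite rmorphXn/= -/ee -{1}(subnK ij) exprD; ring.
have wK i j : i != j -> `|Re (w i j)| + `|Im (w i j)| <= K * e.
  rewrite /w => ij; case: leqP => [ji|]; last first.
    by rewrite !normr0 addr0 mulr_ge0 ?ltW// (lt_le_trans _ K1).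
  have eij : 0 <= e ^+ (i - j) <= e.
    have : (0 < i - j)%N by rewrite subn_gt0 ltn_neqAle ji andbT eq_sym.
    case: (i - j)%N => // q _; rewrite exprn_ge0 ?(ltW e0)//= exprS.
    by rewrite -[leRHS]mulr1 ler_wpM2l ?(ltW e0)// exprn_ile1// ltW.
  rewrite complex_ReM complex_ImM/= !mul0r subr0 addr0 !normrM.
  rewrite ger0_norm; last by case/andP: eij.
  by rewrite -mulrDr mulrC ler_pM ?addr_ge0//; case/andP: eij.
have wd i : w i i = T i i by rewrite /w leqnn subnn expr0 mul1r.
pose S := \sum_i nsq (v i ord0).
have S0 : 0 <= S by apply: sumr_ge0 => i _; exact: nsq_ge0.
have lb i : a * nsq (v i ord0) - K * e * (n%:R * nsq (v i ord0) + S) <=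
    Re (conjc (v i ord0) * (diag_mx d *m (T *m u)) i ord0).
  rewrite TvE mulr_sumr complex_Re_sum (bigD1 i)//= wd.
  have -> : Re (conjc (v i ord0) * (T i i * v i ord0)) =
      Re (T i i) * nsq (v i ord0).
    by case: (v i ord0) => p q; case: (T i i) => r s; rewrite /nsq/=; ring.
  apply: lerD; first by rewrite ler_wpM2r ?nsq_ge0.
  apply: (@le_trans _ _ (\sum_(j | j != i)
      - (K * e * (nsq (v i ord0) + nsq (v j ord0))))).
    rewrite sumrN lerN2 -mulr_sumr ler_wpM2l//.
      by rewrite mulr_ge0 ?(ltW e0)// (le_trans _ K1).
    apply: (@le_trans _ _ (\sum_j (nsq (v i ord0) + nsq (v j ord0)))).
      rewrite [leRHS](bigD1 i)//= lerDr addr_ge0//; exact: nsq_ge0.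
    by rewrite big_split/= sumr_const card_ord mulr_natl.
  by apply: ler_sum => j ji; apply: Re_conj_mulM_ge; apply: wK; rewrite eq_sym.
apply: le_trans (ler_sum _ (fun i _ => lb i)).
have -> : \sum_i (a * nsq (v i ord0) - K * e * (n%:R * nsq (v i ord0) + S)) =
    a * S - (4 * n%:R * K * e) * S / 2.
  rewrite (sumrB _ _ _ _) -mulr_sumr -mulr_sumr; congr (_ - _).
  rewrite big_split/= -mulr_sumr sumr_const card_ord -/S -[S *+ n]mulr_natl.
  by field.
have := ler_wpM2r S0 eK; rewrite -/S; lra.
Qed.

(** Real form of the previous estimate: B stacks Re P and Im P, so that |B x|^2 is the squared
    length of P x for real x, and the left inverse L is read off from the real part of P^-1 P = 1.
    Thus |B x|^2 is the Lyapunov function, and L makes it coercive. *)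
Lemma lyapunov_matrix (n : nat) (A : 'M[R]_n) : (0 < n)%N ->
  (forall l, eigenvalue (cplx A) l -> 0 < Re l) ->
  exists (B : 'M[R]_(n + n, n)) (L : 'M[R]_(n, n + n)), L *m B = 1%:M /\
  exists2 a : R, 0 < a & forall x : 'cV[R]_n,
    a * \sum_i ((B *m x) i ord0) ^+ 2 <=
    \sum_i (B *m x) i ord0 * (B *m (A *m x)) i ord0.
Proof.
move=> n0 /(complex_lyapunov n0)[P [Pu [a a0 aP]]].
pose B1 : 'M[R]_n := map_mx Re P; pose B2 : 'M[R]_n := map_mx Im P.
have ReP (x : 'cV[R]_n) i : Re ((P *m cplx x) i ord0) = (B1 *m x) i ord0.
  rewrite !mxE complex_Re_sum; apply: eq_bigr => j _; rewrite !mxE complex_ReM/= mulr0 subr0//.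
have ImP (x : 'cV[R]_n) i : Im ((P *m cplx x) i ord0) = (B2 *m x) i ord0.
  rewrite !mxE complex_Im_sum; apply: eq_bigr => j _; rewrite !mxE complex_ImM/= mulr0 add0r//.
exists (col_mx B1 B2), (row_mx (map_mx Re (invmx P)) (- map_mx Im (invmx P))).
split.
  rewrite mul_row_col; apply/matrixP => i j.
  have := congr1 (fun M : 'M[C]_n => Re (M i j)) (mulVmx Pu).
  rewrite !mxE complex_Re_sum.
  under eq_bigr do rewrite complex_ReM.
  rewrite sumrB => E; transitivity (Re ((i == j)%:R : C)); last by case: (i == j).
  rewrite -E; congr (_ + _); first by apply: eq_bigr => k _; rewrite !mxE.
  by rewrite -sumrN; apply: eq_bigr => k _; rewrite !mxE mulNr.
exists a => // x; have := aP (cplx x).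
have -> : cplx A *m cplx x = cplx (A *m x) by rewrite /cplx map_mxM.
rewrite !mul_col_mx !big_split_ord/=.
have -> (u v : 'cV[R]_n) : \sum_(i < n) col_mx u v (lshift n i) ord0 ^+ 2 +
    \sum_(i < n) col_mx u v (rshift n i) ord0 ^+ 2 =
    \sum_i (u i ord0 ^+ 2 + v i ord0 ^+ 2).
  rewrite -big_split/=; apply: eq_bigr => i _; by rewrite col_mxEu col_mxEd.
under eq_bigr do rewrite /nsq ReP ImP.
move=> /le_trans; apply; rewrite -big_split/= le_eqVlt; apply/orP; left; apply/eqP.
apply: eq_bigr => i _; rewrite !col_mxEu !col_mxEd -!ReP -!ImP.
by case: ((P *m cplx x) i ord0) => p q;
  case: ((P *m cplx (A *m x)) i ord0) => r s/=; ring.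
Qed.

End Lyapunov.

(** * Stability of the linear equation under small, slowly decaying perturbations *)

Section Stability.
Variable R : realType.

Lemma is_derive_sum_fun (n : nat) (F : 'I_n -> R -> R) (dF : 'I_n -> R) (t : R) :
  (forall i, is_derive t (1 : R) (F i) (dF i)) ->
  is_derive t (1 : R) (fun s => \sum_i F i s) (\sum_i dF i).
Proof.
move=> H; rewrite (_ : (fun s => _) = \sum_i F i); first exact: is_derive_sum.
by apply/funext => s; rewrite fct_sumE.
Qed.

Lemma is_derive_mulmx (m n : nat) (B : 'M[R]_(m, n)) (w : R -> 'cV[R]_n)
    (d : 'cV[R]_n) (t : R) :
  (forall i, is_derive t (1 : R) (fun s => w s i ord0) (d i ord0)) ->
  forall i, is_derive t (1 : R) (fun s => (B *m w s) i ord0) ((B *m d) i ord0).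
Proof.
move=> H i; rewrite mxE (_ : (fun s => _) = fun s => \sum_j B i j * w s j ord0).
  by apply: is_derive_sum_fun => j; exact: (is_deriveZ (B i j)).
by apply/funext => s; rewrite mxE.
Qed.

Lemma is_derive_le0_nincr (F dF : R -> R) (T : R) :
  (forall t, T <= t -> is_derive t (1 : R) F (dF t)) -> (forall t, T <= t -> dF t <= 0) ->
  forall t, T <= t -> F t <= F T.
Proof.
move=> HF dF0 t Tt; apply: (@ler0_derive1_nincry _ F T) => //.
- by move=> x; rewrite inE/= => /andP[/ltW Tx _]; have [] := HF _ Tx.
- move=> x; rewrite inE/= => /andP[/ltW Tx _]; rewrite derive1E.
  by have [_ ->] := HF _ Tx; exact: dF0.
- apply: derivable_within_continuous => x; rewrite in_itv/= andbT => Tx.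
  by have [] := HF _ Tx.
Qed.

Lemma is_derive_mull (c : R) (F : R -> R) (dF t : R) :
  is_derive t (1 : R) F dF -> is_derive t (1 : R) (fun s => c * F s) (c * dF).
Proof. exact: (is_deriveZ c). Qed.

Lemma is_derive_mul (F E : R -> R) (dF dE t : R) :
  is_derive t (1 : R) F dF -> is_derive t (1 : R) E dE ->
  is_derive t (1 : R) (fun s => F s * E s) (dF * E t + F t * dE).
Proof.
move=> HF HE; apply: is_derive_eq (is_deriveM HF HE) _.
by rewrite addrC /GRing.scale/= [dF * _]mulrC.
Qed.

Lemma is_derive_barrier (V b e : R -> R) (dV db de M t : R) :
  is_derive t (1 : R) V dV -> is_derive t (1 : R) b db ->
  is_derive t (1 : R) e de ->
  is_derive t (1 : R) (fun s => (V s - M * b s ^+ 2) * e s)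
    ((dV - M * (2 * b t * db)) * e t + (V t - M * b t ^+ 2) * de).
Proof.
move=> HV Hb He; apply: is_derive_mul => //.
apply: (is_deriveB HV); apply: is_derive_mull.
by apply: is_derive_eq (is_derive_mul Hb Hb) _; ring.
Qed.

(** With V = |B w|^2 one gets V' <= - a V + C2 b^2. Since b decays at rate at most eta, a multiple M
    b^2 is a supersolution and (V - M b^2) e^(a t) is nonincreasing. The constant eta is fixed by A
    before w, h, b and C are given. *)
Lemma stability (n : nat) (A : 'M[R]_n) : (0 < n)%N ->
  (forall l, eigenvalue (cplx A) l -> 0 < complex.Re l) ->
  exists2 eta : R, 0 < eta &
  forall (w h : R -> 'cV[R]_n) (b db : R -> R) (C : R),
    (\forall t \near +oo_R, forall i,
       is_derive t (1 : R) (fun s => w s i ord0) ((- (A *m w t) + h t) i ord0)) ->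
    (\forall t \near +oo_R, is_derive t (1 : R) b (db t)) ->
    (\forall t \near +oo_R, 0 < b t) ->
    (\forall t \near +oo_R, - (eta * b t) <= db t) ->
    (\forall t \near +oo_R, `|h t| <= eta * `|w t| + C * b t) ->
    exists D, \forall t \near +oo_R, `|w t| <= D * b t.
Proof.
move=> n0 /(lyapunov_matrix n0)[B [L [LB [a a0 aB]]]].
(* K1 comes from pairing B w with B h, K2 from recovering w as L (B w). *)
pose K1 : R := (n + n)%:R * (n%:R * `|B|).
pose K2 : R := (n + n)%:R * `|L|.
have K10 : 0 <= K1 by rewrite !mulr_ge0.
have K20 : 0 <= K2 by rewrite !mulr_ge0.
pose K := 1 + K1 * K2.
have K0 : 0 < K by rewrite ltr_pwDl// mulr_ge0.
(* The bound a / 4 serves the slow variation of b; the bound a / (4 K) lets the term eta |w| be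
   absorbed into - a V. *)
pose eta := Num.min (a / 4) (a / (4 * K)).
have eta0 : 0 < eta by rewrite lt_min !divr_gt0// mulr_gt0.
have eta1 : eta <= a / 4 by rewrite ge_min lexx.
have eta2 : K1 * K2 * eta <= a / 4.
  have : eta <= a / (4 * K) by rewrite ge_min lexx orbT.
  rewrite ler_pdivlMr ?mulr_gt0// => e.
  have : eta * (1 + K1 * K2) <= a / 4 by rewrite -/K; clear -e; lra.
  by move=> e'; clear -e' eta0; lra.
exists eta => // w h b db C Hw Hb b0 Hdb Hh.
near +oo_R => T.
have HT : forall t, T <= t -> [/\ (forall i,
       is_derive t (1 : R) (fun s => w s i ord0) ((- (A *m w t) + h t) i ord0)),
       is_derive t (1 : R) b (db t), 0 < b t, - (eta * b t) <= db t &
       `|h t| <= eta * `|w t| + C * b t].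
  near: T.
  have [T0 [_ HT0]] : \forall t \near +oo_R, [/\ (forall i,
       is_derive t (1 : R) (fun s => w s i ord0) ((- (A *m w t) + h t) i ord0)),
       is_derive t (1 : R) b (db t), 0 < b t, - (eta * b t) <= db t &
       `|h t| <= eta * `|w t| + C * b t].
    by near=> t; split; near: t.
  exists T0; split; first exact: num_real.
  by move=> T T0T t Tt; apply: HT0; exact: lt_le_trans Tt.
pose z t := B *m w t.
pose V t := \sum_i z t i ord0 ^+ 2.
(* From Young's inequality K1 C x b <= a / 4 x^2 + (K1 C)^2 / a b^2, doubled because V' is twice a
   scalar product. *)
pose C2 := 2 * (K1 * C) ^+ 2 / a.
have C20 : 0 <= C2 by rewrite divr_ge0 ?(ltW a0)// mulr_ge0 ?sqr_ge0.
have zV t : `|z t| ^+ 2 <= V t by exact: sqr_norm_le_sum.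
have V0 t : 0 <= V t by exact: le_trans (zV t); rewrite sqr_ge0.
have wz t : `|w t| <= K2 * `|z t|.
  by rewrite -{1}[w t]mul1mx -LB -mulmxA norm_mulmx_le.
pose dV t := \sum_i 2 * z t i ord0 * (B *m (- (A *m w t) + h t)) i ord0.
have HV t : T <= t -> is_derive t (1 : R) V (dV t).
  move=> Tt; apply: is_derive_sum_fun => i.
  have [Hz _ _ _ _] := HT t Tt.
  have := is_deriveX 2 (is_derive_mulmx B Hz i).
  rewrite /GRing.scale/= expr1.
  by rewrite (_ : (fun s => (B *m w s) i ord0) ^+ 2 = (fun s => z s i ord0 ^+ 2)).
have dV_le t : T <= t -> dV t <= - (a * V t) + C2 * b t ^+ 2.
  move=> Tt; have [_ _ bt0 _ ht] := HT t Tt.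
  have -> : dV t = - 2 * (\sum_i z t i ord0 * (B *m (A *m w t)) i ord0) +
      2 * \sum_i z t i ord0 * (B *m h t) i ord0.
    rewrite /dV mulmxDr mulmxN !mulr_sumr -big_split/=; apply: eq_bigr => i _.
    move: (z t i ord0) (B *m (A *m w t)) (B *m h t) => c r q.
    by rewrite !mxE; ring.
  have E1 := aB (w t); rewrite -/(z t) -/(V t) in E1.
  have E2 : \sum_i z t i ord0 * (B *m h t) i ord0 <= K1 * `|z t| * `|h t|.
    apply: (@le_trans _ _ (\sum_(i < n + n) `|z t| * (n%:R * `|B| * `|h t|))).
      apply: ler_sum => i _; apply: le_trans (ler_norm _) _.
      rewrite normrM ler_pM ?coord_le_norm//.
      by apply: le_trans (coord_le_norm _ _ _) (norm_mulmx_le _ _).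
    rewrite sumr_const card_ord -[leLHS]mulr_natl /K1 le_eqVlt; apply/orP; left.
    by apply/eqP; ring.
  have E3 : K1 * `|z t| * `|h t| <=
      K1 * `|z t| * (eta * (K2 * `|z t|) + C * b t).
    rewrite ler_wpM2l ?mulr_ge0// (le_trans ht)// lerD2r ler_wpM2l ?(ltW eta0)//.
  have z0 : 0 <= `|z t| by [].
  have := zV t; move: (`|z t|) z0 E2 E3 => x x0 E2 E3 xV.
  have E4 : K1 * x * (eta * (K2 * x) + C * b t) <=
      a / 4 * x ^+ 2 + (a / 4 * x ^+ 2 + (K1 * C) ^+ 2 / a * b t ^+ 2).
    rewrite mulrDr; apply: lerD.
      have -> : K1 * x * (eta * (K2 * x)) = K1 * K2 * eta * x ^+ 2 by ring.
      by rewrite ler_wpM2r ?sqr_ge0.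
    have : 0 <= a^-1 * (a / 2 * x - K1 * C * b t) ^+ 2.
      by rewrite mulr_ge0 ?sqr_ge0// invr_ge0 ltW.
    rewrite (_ : a^-1 * _ = a / 4 * x ^+ 2 - K1 * x * (C * b t) + (K1 * C) ^+ 2 / a * b t ^+ 2).
      by move=> F; clear -F; lra.
    by field; rewrite gt_eqF.
  have : C2 * b t ^+ 2 = 2 * ((K1 * C) ^+ 2 / a * b t ^+ 2) by rewrite /C2; ring.
  have : a * x ^+ 2 <= a * V t by rewrite ler_wpM2l// ltW.
  move: E1 E2 E3 E4; rewrite -/(V t) => E1 E2 E3 E4 E5 E6.
  by clear -E1 E2 E3 E4 E5 E6; lra.
have [_ _ bT0 _ _] := HT T (lexx T).
(* The first summand makes the derivative of [Z] below nonpositive, the second makes [Z] nonpositive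
   at T. *)
pose M := 2 * C2 / a + V T / b T ^+ 2.
have a0' := ltW a0.
have VT0 : 0 <= V T / b T ^+ 2 by exact: divr_ge0 (V0 T) (sqr_ge0 _).
have CA0 : 0 <= 2 * C2 / a by apply: divr_ge0 => //; exact: mulr_ge0.
have M0 : 0 <= M by exact: addr_ge0.
have M1 : 2 * C2 <= a * M.
  have : a * (2 * C2 / a) = 2 * C2 by field; rewrite gt_eqF.
  have : 0 <= a * (V T / b T ^+ 2) by exact: mulr_ge0.
  rewrite /M mulrDr => F1 F2; clear -F1 F2; lra.
have M2 : V T <= M * b T ^+ 2.
  by rewrite -ler_pdivrMr ?exprn_gt0// /M lerDr.
pose Z t := (V t - M * b t ^+ 2) * expR (a * t).
pose dZ t := (dV t - M * (2 * b t * db t)) * expR (a * t) +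
  (V t - M * b t ^+ 2) * (a * expR (a * t)).
have HZ t : T <= t -> is_derive t (1 : R) Z (dZ t).
  move=> Tt; have [_ Hbt _ _ _] := HT t Tt; have HVt := HV t Tt.
  have He : is_derive t (1 : R) (fun s => expR (a * s)) (a * expR (a * t)).
    have H1 : is_derive t (1 : R) (fun s : R => a * s) a.
      by have := is_deriveZ a (is_derive_id t (1 : R)); rewrite /GRing.scale/= mulr1.
    have := is_derive1_comp (f := expR) (g := fun s => a * s) (x := t)
      (is_derive_expR (a * t)) H1.
    by rewrite mulrC.
  exact: is_derive_barrier.
have ZT t : T <= t -> Z t <= Z T.
  move=> Tt; apply: (is_derive_le0_nincr HZ) => // s Ts; rewrite /dZ.
  have -> : (dV s - M * (2 * b s * db s)) * expR (a * s) +
    (V s - M * b s ^+ 2) * (a * expR (a * s)) =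
    (dV s - M * (2 * b s * db s) + a * V s - a * M * b s ^+ 2) * expR (a * s) by ring.
  have [_ _ bs0 dbs _] := HT s Ts.
  have F1 := dV_le s Ts.
  have F2 : - (M * (2 * b s * db s)) <= 2 * M * eta * b s ^+ 2.
    have : 0 <= 2 * M * b s * (db s + eta * b s).
      by rewrite !mulr_ge0// ?(ltW bs0)//; clear -dbs; lra.
    by move=> F; clear -F; lra.
  have F3 : 2 * M * eta * b s ^+ 2 <= a / 2 * M * b s ^+ 2.
    rewrite ler_wpM2r ?sqr_ge0//.
    have : M * eta <= M * (a / 4) by rewrite ler_wpM2l.
    by move=> F; clear -F; lra.
  have F4 : 2 * C2 * b s ^+ 2 <= a * M * b s ^+ 2 by rewrite ler_wpM2r ?sqr_ge0.
  rewrite mulr_le0_ge0 ?expR_ge0//.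
  by clear -F1 F2 F3 F4; lra.
exists (K2 * Num.sqrt M); near=> t.
have Tt : T <= t by near: t; apply: nbhs_pinfty_ge; exact: num_real.
have [_ _ bt0 _ _] := HT t Tt.
have VM : V t <= M * b t ^+ 2.
  have Zle0 : Z t <= 0.
    by apply: le_trans (ZT t Tt) _; rewrite mulr_le0_ge0 ?expR_ge0// subr_le0.
  by move: Zle0; rewrite /Z pmulr_lle0 ?expR_gt0// subr_le0.
apply: le_trans (wz t) _; rewrite -mulrA ler_wpM2l//.
rewrite -ler_sqr ?nnegrE ?mulr_ge0 ?sqrtr_ge0 ?(ltW bt0)//.
by rewrite exprMn sqr_sqrtr// (le_trans (zV t)).
Unshelve. all: by end_near. Qed.

End Stability.

(** * Multilinear maps and the nonlinear sum *)

Section Multilinear.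
Variables (R : realType) (n m : nat) (g : ('I_m -> 'cV[R]_n) -> 'cV[R]_n).
Hypothesis g_lin : multilinear_map g.

Local Notation subst v i w := (fun j => if j == i then w else v j).

Lemma multilinear_subst0 v i : g (subst v i 0) = 0.
Proof.
have := g_lin v i (-1) 0 0; rewrite /= scaler0 addr0 => {1}->.
by rewrite scaleN1r addNr.
Qed.

Lemma multilinear_substD v i x y :
  g (subst v i (x + y)) = g (subst v i x) + g (subst v i y).
Proof. by have := g_lin v i 1 x y; rewrite /= !scale1r. Qed.

Lemma multilinear_substZ v i a x : g (subst v i (a *: x)) = a *: g (subst v i x).
Proof.
by have := g_lin v i a x 0; rewrite /= addr0 multilinear_subst0 addr0.
Qed.

Lemma multilinear_subst_sum v i (I : finType) (u : I -> 'cV[R]_n) :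
  g (subst v i (\sum_k u k)) = \sum_k g (subst v i (u k)).
Proof.
exact: (big_morph (fun x => g (subst v i x)) (multilinear_substD v i)
  (multilinear_subst0 v i)).
Qed.

Lemma multilinear_sum (I : finType) (k0 : I) (v : 'I_m -> I -> 'cV[R]_n) :
  g (fun l => \sum_k v l k) =
  \sum_(j : {ffun 'I_m -> I}) g (fun l => v l (j l)).
Proof.
(* The arguments are expanded one at a time along the list r. Index functions stay total: at
   positions not yet expanded they are pinned to k0, so every partial expansion is a sum over the
   same type. *)
pose Pf (r : seq 'I_m) (j : {ffun 'I_m -> I}) :=
  [forall l, (l \notin r) ==> (j l == k0)].
suff H r : uniq r -> forall x : 'I_m -> 'cV[R]_n,
    g (fun l => if l \in r then \sum_k v l k else x l) =
    \sum_(j | Pf r j) g (fun l => if l \in r then v l (j l) else x l).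
  have := H (enum 'I_m) (enum_uniq _) (fun=> 0).
  rewrite (_ : (fun l => _) = fun l => \sum_k v l k); last first.
    by apply/funext => l; rewrite mem_enum.
  move=> ->; apply: eq_big => [j|j _].
    by apply/forallP => l; rewrite mem_enum.
  by congr g; apply/funext => l; rewrite mem_enum.
elim: r => [_ x|i r IHr /= /andP[nri Ur] x].
  rewrite (big_pred1 [ffun=> k0]) ?big_nil//= => j.
  apply/forallP/eqP => [jP|->{j} l]; last by rewrite ffunE eqxx implybT.
  by apply/ffunP => l; rewrite ffunE; apply/eqP; have := jP l.
rewrite (_ : (fun l => _) = subst (fun l => if l \in r then \sum_k v l k else x l)
    i (\sum_k v i k)); last first.
  by apply/funext => l; rewrite inE; case: eqVneq => //= ->.
rewrite multilinear_subst_sum [RHS](partition_big (fun j : {ffun 'I_m -> I} => j i)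
  predT)//=; apply: eq_bigr => k _.
transitivity (g (fun l => if l \in r then \sum_k v l k else
   if l == i then v i k else x l)).
  by congr g; apply/funext => l; case: eqVneq => // ->; rewrite (negbTE nri).
rewrite (IHr Ur (fun l => if l == i then v i k else x l)).
(* Changing the value at i from k0 to k is a bijection from the index functions of the induction
   hypothesis onto the fibre over k. *)
pose seti k' (j : {ffun 'I_m -> I}) := [ffun l => if l == i then k' else j l].
rewrite [RHS](reindex_onto (seti k) (seti k0))/=; last first.
  move=> j /andP[_ /eqP ji]; apply/ffunP => l; rewrite !ffunE.
  by case: eqVneq => // ->.
apply: eq_big => [j|j _]; last first.
  congr g; apply/funext => l; rewrite inE ffunE.
  by case: eqVneq => //= ->; rewrite (negbTE nri).
rewrite ffunE eqxx eqxx andbT; apply/forallP/andP => [jP|[/forallP jP /eqP ji] l].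
  split; first by apply/forallP => l; rewrite inE ffunE negb_or; have := jP l;
    case: (eqVneq l i).
  apply/eqP/ffunP => l; rewrite !ffunE; case: eqVneq => // ->.
  by have := jP i; rewrite nri => /eqP.
have := jP l; rewrite inE ffunE negb_or; case: (eqVneq l i) => //= -> _.
by rewrite -ji !ffunE eqxx eqxx implybT.
Qed.

Lemma multilinear_scale (c : 'I_m -> R) (x : 'I_m -> 'cV[R]_n) :
  g (fun l => c l *: x l) = (\prod_l c l) *: g x.
Proof.
suff H r : uniq r ->
    g (fun l => if l \in r then c l *: x l else x l) = (\prod_(l <- r) c l) *: g x.
  have := H (index_enum _) (index_enum_uniq _) => <-.
  by congr g; apply/funext => l; rewrite mem_index_enum.
elim: r => [_|i r IHr /= /andP[nri Ur]]; first by rewrite big_nil scale1r.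
rewrite big_cons -scalerA -IHr// -[in RHS](_ : subst (fun l => if l \in r then
   c l *: x l else x l) i (x i) = fun l => if l \in r then c l *: x l else x l).
  rewrite -multilinear_substZ; congr g; apply/funext => l.
  by rewrite inE; case: eqVneq => //= ->.
by apply/funext => l; case: eqVneq => // ->; rewrite (negbTE nri).
Qed.

Lemma multilinear_basis (i0 : 'I_n) (v : 'I_m -> 'cV[R]_n) :
  g v = \sum_(j : {ffun 'I_m -> 'I_n})
    (\prod_l v l (j l) ord0) *: g (fun l => delta_mx (j l) ord0).
Proof.
transitivity (g (fun l => \sum_i v l i ord0 *: delta_mx i ord0)).
  congr g; apply/funext => l; apply/matrixP => i k.
  rewrite (ord1 k) summxE (bigD1 i)//= big1 => [|i' ii'].
    by rewrite !mxE !eqxx mulr1 addr0.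
  by rewrite !mxE eq_sym (negbTE ii') mulr0.
rewrite (multilinear_sum i0); apply: eq_bigr => j _.
by rewrite (multilinear_scale (fun l => v l (j l) ord0)).
Qed.

Lemma multilinear_bound (i0 : 'I_n) : exists2 C : R, 0 <= C &
  forall v, `|g v| <= C * \prod_l `|v l|.
Proof.
exists (\sum_(j : {ffun 'I_m -> 'I_n}) `|g (fun l => delta_mx (j l) ord0)|).
  exact: sumr_ge0.
move=> v; rewrite (multilinear_basis i0) mulr_suml.
apply: le_trans (ler_norm_sum _ _ _) _; apply: ler_sum => j _.
rewrite normrZ mulrC ler_wpM2l// normr_prod; apply: ler_prod => l _.
by rewrite normr_ge0 coord_le_norm.
Qed.

End Multilinear.

(** * Finiteness of the nonlinear sum *)

Section NonlinearSum.
Variables (R : realType) (n : nat) (mu : nat -> R).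
Hypothesis mu_gt0 : forall k, 0 < mu k.
Hypothesis mu_inc : forall j k, (j < k)%N -> mu j < mu k.
Variable calG : forall m, ('I_m -> 'cV[R]_n) -> 'cV[R]_n.

Lemma mu_le j k : (mu j <= mu k) = (j <= k)%N.
Proof.
case: (ltngtP j k) => [/mu_inc/ltW//|/mu_inc|->]; last by rewrite lexx.
by rewrite ltNge => /negbTE.
Qed.

Lemma mu_lt j k : (mu j < mu k) = (j < k)%N.
Proof. by rewrite ltNge mu_le -ltnNge. Qed.

Lemma mu_inj j k : mu j = mu k -> j = k.
Proof. by move=> e; apply/eqP; rewrite eqn_leq -!mu_le e lexx. Qed.

(** At least one further summand is present, and all are positive. This is what makes the recursion
    for q_k refer to earlier indices only. *)
Lemma index_lt_of_sum (m : nat) (j : 'I_m -> nat) (k : nat) (l : 'I_m) :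
  (2 <= m)%N -> \sum_l mu (j l) <= mu k -> (j l < k)%N.
Proof.
move=> m2 jk; rewrite -mu_lt; apply: lt_le_trans jk.
rewrite (bigD1 l)//= ltrDl.
have [l' ll'] : exists l' : 'I_m, l' != l.
  case: m m2 j l => [|[|m]]// _ _ l; exists (if l == ord0 then ord_max else ord0).
  by case: (eqVneq l ord0) => [->//|]; rewrite eq_sym.
by rewrite (bigD1 l')//= ltr_pwDl// sumr_ge0// => i _; exact: ltW.
Qed.

Lemma sum_mu_ge (m : nat) (j : 'I_m -> nat) : m%:R * mu 0%N <= \sum_l mu (j l).
Proof.
rewrite mulr_natl -[X in _ *+ X](card_ord m) -sumr_const.
by apply: ler_sum => l _; rewrite mu_le.
Qed.

(** Large degrees contribute nothing by [sum_mu_ge], and all indices stay below k by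
    [index_lt_of_sum]. K and M are free above their thresholds, so that several k can share one
    range of summation. *)
Lemma nonlinear_sumE (nn : nat -> nat)
    (q : forall k, 'rV[R]_(nn k).+2 -> 'cV[R]_n) (k K M : nat)
    (z : 'rV[R]_(nn k).+2) :
  (k <= K)%N -> mu k < M.+1%:R * mu 0%N ->
  nonlinear_sum mu calG q z =
  \sum_(2 <= m < M.+1) \sum_(j : {ffun 'I_m -> 'I_K} | \sum_l mu (j l) == mu k)
    calG (fun l => q (j l) (ztrunc (nn (j l)) z)).
Proof.
move=> kK kM; rewrite /nonlinear_sum.
rewrite (fsbigE (index_iota 2 M.+1)) ?iota_uniq//; last 2 first.
- by move=> m /=; rewrite mem_index_iota => /andP[].
- move=> m /= m2; rewrite mem_index_iota m2/= -leqNgt => Mm.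
  apply: fsbig1 => j /= jk; have := sum_mu_ge j; rewrite jk => /le_lt_trans/(_ kM).
  by rewrite ltr_pM2r// ltr_nat ltnNge Mm.
rewrite -big_filter (_ : [seq _ <- _ | _] = index_iota 2 M.+1); last first.
  apply/all_filterP/allP => m; rewrite mem_index_iota => /andP[m2 _].
  by rewrite inE.
apply: eq_big_nat => m /andP[m2 _].
pose up (j : {ffun 'I_m -> 'I_K}) : {ffun 'I_m -> nat} := [ffun l => val (j l)].
pose Q k := q k (ztrunc (nn k) z).
rewrite (fsbig_fwiden (map up (enum
  [pred j : {ffun 'I_m -> 'I_K} | \sum_l mu (j l) == mu k]))).
- rewrite big_map big_enum/=; apply: eq_bigr => j _.
  by congr calG; apply/funext => l; rewrite -/(Q _) ffunE.
- move=> j /= jk; apply/mapP.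
  have jK l : (j l < K)%N.
    by apply: leq_trans kK; apply: (index_lt_of_sum _ m2); rewrite jk.
  exists [ffun l => Ordinal (jK l)].
    by rewrite mem_enum inE; apply/eqP; rewrite -jk; apply: eq_bigr => l _; rewrite ffunE.
  by apply/ffunP => l; rewrite !ffunE.
- rewrite map_inj_uniq ?enum_uniq// => j j' /ffunP jj'; apply/ffunP => l.
  by apply: val_inj; have := jj' l; rewrite !ffunE.
- move=> j [/= /mapP[j' + ->] []]; rewrite mem_enum inE => /eqP <-.
  by apply: eq_bigr => l _; rewrite ffunE.
Qed.

End NonlinearSum.

(** * Finite sums of power functions *)

Section PowerFunctions.
Variable R : realType.
Local Notation C := R[i].

Lemma cexpD (a b : C) : cexp (a + b) = cexp a * cexp b.
Proof.
rewrite /cexp complex_ReD complex_ImD expRD cosD sinD; apply/eqP; rewrite eq_complex.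
by rewrite /=; apply/andP; split; apply/eqP; ring.
Qed.

Lemma cexp0 : cexp (0 : C) = 1.
Proof. by rewrite /cexp/= expR0 cos0 sin0 mul1r. Qed.

Lemma cexp_conj (a : C) : cexp (conjc a) = conjc (cexp a).
Proof.
case: a => a b; rewrite /cexp/= cosN sinN; apply/eqP; rewrite eq_complex/=.
by rewrite !mul0r; apply/andP; split; apply/eqP; ring.
Qed.

Lemma cexp_sum (I : Type) (r : seq I) (P : pred I) (F : I -> C) :
  cexp (\sum_(i <- r | P i) F i) = \prod_(i <- r | P i) cexp (F i).
Proof. exact: (big_morph _ cexpD cexp0). Qed.

Lemma cpowD (t : R) (a b : C) : cpow t (a + b) = cpow t a * cpow t b.
Proof. by rewrite /cpow mulrDl cexpD. Qed.

Lemma cpow0 (t : R) : cpow t 0 = 1.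
Proof. by rewrite /cpow mul0r cexp0. Qed.

Lemma cpow_conj (t : R) (a : C) : cpow t (conjc a) = conjc (cpow t a).
Proof.
by rewrite /cpow -cexp_conj rmorphM; congr (cexp (_ * _)); exact/esym/conjc_real.
Qed.

Lemma cpowN1 (t : R) : 0 < t -> cpow t (- 1) = real_complex R t^-1.
Proof.
move=> t0; rewrite /cpow mulN1r /cexp/= oppr0 cos0 sin0 expRN lnK ?posrE//.
by rewrite mulr1.
Qed.

Section Fixed.
Variable k : nat.
Implicit Types (a b : 'rV[C]_k.+2) (z : 'rV[R]_k.+2).

Lemma zpowD z a b : zpow z (a + b) = zpow z a * zpow z b.
Proof. by rewrite -big_split/=; apply: eq_bigr => i _; rewrite mxE cpowD. Qed.

Lemma zpow0 z : zpow z 0 = 1.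
Proof. by apply: big1 => i _; rewrite mxE cpow0. Qed.

Lemma zpow_conj z a : zpow z (map_mx conjc a) = conjc (zpow z a).
Proof. by rewrite rmorph_prod/=; apply: eq_bigr => i _; rewrite mxE cpow_conj. Qed.

Lemma expo_classD m mu nu a b : expo_class m mu a -> expo_class m nu b ->
  expo_class m (mu + nu) (a + b).
Proof.
move=> Ha Hb i; have [a1 a2] := Ha i; have [b1 b2] := Hb i.
rewrite mxE complex_ReD; split=> im; first by rewrite a1// b1// addr0.
by rewrite a2// b2.
Qed.

Lemma expo_class0 m : expo_class m 0 (0 : 'rV[C]_k.+2).
Proof. by move=> i; rewrite mxE. Qed.

Lemma expo_class_conj m mu a :
  expo_class m mu a -> expo_class m mu (map_mx conjc a).
Proof. by move=> Ha i; rewrite mxE; have := Ha i; case: (a ord0 i). Qed.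

End Fixed.

Section Truncation.
Variables j k : nat.
Hypothesis jk : (j <= k)%N.

Definition zext (a : 'rV[C]_j.+2) : 'rV[C]_k.+2 :=
  \row_i (if (i < j.+2)%N then a ord0 (inord i) else 0).

Lemma zpow_ztrunc (z : 'rV[R]_k.+2) a : zpow (ztrunc j z) a = zpow z (zext a).
Proof.
have jk2 : (j.+2 <= k.+2)%N by [].
rewrite /zpow [RHS](bigID (fun i : 'I_k.+2 => (i < j.+2)%N))/= [X in _ * X]big1.
  rewrite mulr1 (big_ord_narrow jk2)/=; apply: eq_bigr => i _; rewrite !mxE/=.
  have -> : inord i = widen_ord jk2 i :> 'I_k.+2.
    by apply: val_inj; rewrite /= inordK// (leq_trans (ltn_ord i)).
  by rewrite ltn_ord inord_val.
by move=> i /negbTE ij; rewrite mxE ij cpow0.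
Qed.

Lemma expo_class_zext m mu a : (m <= j)%N ->
  expo_class m mu a -> expo_class m mu (zext a).
Proof.
move=> mj Ha i; rewrite mxE; case: ifPn => [ij|].
  by have := Ha (inord i); rewrite inordK.
rewrite -leqNgt => ji; split => // im.
by move: ji; rewrite im !ltnS ltnNge mj.
Qed.

Lemma posz_ztrunc (z : 'rV[R]_k.+2) : posz z -> posz (ztrunc j z).
Proof. by move=> z0 i; rewrite mxE. Qed.

End Truncation.

(** The weights in R are themselves power functions, with exponent -1 at the positions of z_0, ...,
    z_j; position 0 belongs to e^t and gets exponent 0. *)
Lemma inv_prod_zpow (k : nat) (z : 'rV[R]_k.+2) (j : 'I_k.+1) : posz z ->
  real_complex R (\prod_(l < k.+1 | (l <= j)%N) (z ord0 (lift ord0 l))^-1) =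
  zpow z (\row_i (if (0 < i <= j.+1)%N then -1 else 0)).
Proof.
move=> z0; rewrite /zpow big_ord_recl mxE/= cpow0 mul1r rmorph_prod big_mkcond/=.
apply: eq_bigr => l _; rewrite mxE /= /bump/= add1n ltnS.
by case: ifP => _; rewrite ?cpow0// cpowN1.
Qed.

(** Hence R lowers the exponent of z_0 by one, the origin of the condition mu_lambda + 1 = mu_k. *)
Lemma expo_class_inv_prod (k : nat) (j : 'I_k.+1) :
  expo_class 0 (- 1 : R) (\row_(i < k.+2) (if (0 < i <= j.+1)%N then -1 else 0)).
Proof. by move=> i; rewrite mxE; split; case: i => [[|[|i]]]. Qed.

End PowerFunctions.

(** * Term lists representing sums of power functions *)

Section TermLists.
Variable R : realType.
Local Notation C := R[i].
Local Notation Re := (@complex.Re R).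

(** Exponents may repeat in a list of terms: addition is concatenation and products are lists of
    pairs, with nothing to collect. [tsupp] and [tcoef] collect equal exponents when the form of
    [gpoly] is required. *)
Definition term (n k : nat) : Type := ('rV[C]_k.+2 * 'cV[C]_n)%type.

Definition tsum (n k : nat) (s : seq (term n k)) (z : 'rV[R]_k.+2) : 'cV[C]_n :=
  \sum_(x <- s) zpow z x.1 *: x.2.

Definition tsupp (n k : nat) (s : seq (term n k)) : {fset 'rV[C]_k.+2} :=
  [fset a | a in map fst s]%fset.

Definition tcoef (n k : nat) (s : seq (term n k)) (a : 'rV[C]_k.+2) : 'cV[C]_n :=
  \sum_(x <- s | x.1 == a) x.2.

Definition tmap (n k : nat) (h : 'rV[C]_k.+2 -> 'cV[C]_n -> 'cV[C]_n)
    (s : seq (term n k)) : seq (term n k) := [seq (x.1, h x.1 x.2) | x <- s].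

Definition tclass (n k m : nat) (mu : R) (s : seq (term n k)) : Prop :=
  forall x, x \in s -> expo_class m mu x.1.

Definition treal (n k : nat) (s : seq (term n k)) (z : 'rV[R]_k.+2) : 'cV[R]_n :=
  map_mx Re (tsum s z).

(* Averaging with the conjugate family does not change real-valued sums and
   yields coefficients with the symmetry required in [P_class]. *)
Definition tsym (n k : nat) (s : seq (term n k)) : seq (term n k) :=
  [seq (x.1, 2^-1 *: x.2) | x <- s] ++
  [seq (map_mx conjc x.1, 2^-1 *: map_mx conjc x.2) | x <- s].

(** Collecting equal exponents commutes with every operator acting additively on coefficients; the
    M_j, Z_A and the identity are of this kind. *)
Lemma gpoly_tsupp (n k : nat) (h : 'rV[C]_k.+2 -> 'cV[C]_n -> 'cV[C]_n)
    (s : seq (term n k)) z :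
  (forall a, h a 0 = 0) -> (forall a, {morph h a : x y / x + y}) ->
  gpoly (tsupp s) (fun a => h a (tcoef s a)) z = tsum (tmap h s) z.
Proof.
move=> h0 hD; rewrite /gpoly /tsum big_map.
transitivity (\sum_(a <- tsupp s) \sum_(x <- s | x.1 == a) zpow z x.1 *: h x.1 x.2).
  apply: eq_bigr => a _; rewrite /tcoef (big_morph (h a) (hD a) (h0 a)) scaler_sumr.
  by apply: eq_bigr => x /eqP ->.
rewrite (exchange_big_dep xpredT)//= big_seq [RHS]big_seq; apply: eq_bigr => x xs.
transitivity (\sum_(a <- tsupp s | a == x.1) zpow z x.1 *: h x.1 x.2).
  by apply: eq_bigl => a; rewrite eq_sym.
rewrite -big_filter (filter_pred1_uniq (fset_uniq _)) ?big_seq1//.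
by rewrite !inE/=; apply: map_f.
Qed.

Lemma gpoly_tsum (n k : nat) (s : seq (term n k)) z :
  gpoly (tsupp s) (tcoef s) z = tsum s z.
Proof.
rewrite (@gpoly_tsupp _ _ (fun _ x => x))// /tmap (_ : map _ s = s)//.
by rewrite -[RHS]map_id; apply: eq_map => -[].
Qed.

Lemma map_conjcZ (n : nat) (c : C) (x : 'cV[C]_n) :
  map_mx conjc (c *: x) = conjc c *: map_mx conjc x.
Proof. by apply/matrixP => i j; rewrite !mxE rmorphM. Qed.

Lemma map_conjcD (n : nat) (x y : 'cV[C]_n) :
  map_mx conjc (x + y) = map_mx conjc x + map_mx conjc y.
Proof. by apply/matrixP => i j; rewrite !mxE rmorphD. Qed.

Lemma map_conjcK (m n : nat) (x : 'M[C]_(m, n)) :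
  map_mx conjc (map_mx conjc x) = x.
Proof. by apply/matrixP => i j; rewrite !mxE conjcK. Qed.

Lemma map_conjc_sum (n : nat) (I : Type) (r : seq I) (P : pred I) (F : I -> 'cV[C]_n) :
  map_mx conjc (\sum_(i <- r | P i) F i) = \sum_(i <- r | P i) map_mx conjc (F i).
Proof. by apply: (big_morph _ (@map_conjcD n)); apply/matrixP => i j; rewrite !mxE conjc0. Qed.

Lemma conjc2V : conjc (2^-1 : C) = 2^-1.
Proof. by rewrite conjc_inv conjc_nat. Qed.

Lemma tsum_tsym (n k : nat) (s : seq (term n k)) z :
  tsum (tsym s) z = cplx (treal s z).
Proof.
rewrite /tsum /tsym big_cat/= !big_map/=.
have -> : \sum_(x <- s) zpow z x.1 *: (2^-1 *: x.2) = 2^-1 *: tsum s z.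
  by rewrite scaler_sumr; apply: eq_bigr => x _; rewrite !scalerA mulrC.
have -> : \sum_(x <- s) zpow z (map_mx conjc x.1) *: (2^-1 *: map_mx conjc x.2) =
    2^-1 *: map_mx conjc (tsum s z).
  rewrite map_conjc_sum scaler_sumr; apply: eq_bigr => x _.
  by rewrite zpow_conj map_conjcZ !scalerA mulrC.
apply/matrixP => i j; rewrite !mxE [real_complex R _]ReJ_add; ring.
Qed.

Lemma tsym_tmap (n k : nat) (h : 'rV[C]_k.+2 -> 'cV[C]_n -> 'cV[C]_n)
    (s : seq (term n k)) :
  (forall a c x, h a (c *: x) = c *: h a x) ->
  (forall a x, h (map_mx conjc a) (map_mx conjc x) = map_mx conjc (h a x)) ->
  tsym (tmap h s) = tmap h (tsym s).
Proof.
move=> hZ hJ; rewrite /tsym /tmap map_cat -!map_comp; congr (_ ++ _);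
  by apply: eq_map => x /=; rewrite hZ ?hJ.
Qed.

Lemma tclass_tsym (n k m : nat) (mu : R) (s : seq (term n k)) :
  tclass m mu s -> tclass m mu (tsym s).
Proof.
move=> sP x; rewrite mem_cat => /orP[]/mapP[y ys ->]/=; first exact: sP.
by apply: expo_class_conj; exact: sP.
Qed.

Lemma tclass_tmap (n k m : nat) (mu : R) h (s : seq (term n k)) :
  tclass m mu s -> tclass m mu (tmap h s).
Proof. by move=> sP x /mapP[y ys ->]/=; exact: sP. Qed.

Lemma mem_tsupp (n k : nat) (s : seq (term n k)) a :
  (a \in tsupp s) = (a \in map fst s).
Proof. by rewrite !inE. Qed.

(** The list s is arbitrary; its symmetrisation supplies the conjugation-invariant support and
    coefficients. Conjugation exchanges the two halves of [tsym s], hence the swap of the summands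
    in the proof. *)
Lemma P_class_treal (n k m : nat) (mu : R) (s : seq (term n k)) :
  tclass m mu s -> P_class m mu (treal s).
Proof.
move=> sP; exists (tsupp (tsym s)), (tcoef (tsym s)); split.
- move=> a; rewrite !mem_tsupp /tsym !map_cat -!map_comp !mem_cat.
  move=> /orP[]/mapP[x xs ->]/=; apply/orP; [right|left]; apply/mapP; exists x => //=.
  by rewrite map_conjcK.
- move=> a _; rewrite /tcoef /tsym !big_cat/= !big_map/= addrC map_conjcD.
  rewrite !map_conjc_sum; congr (_ + _).
    apply: eq_big => [x|x _]; last by rewrite map_conjcZ conjc2V.
    by apply/eqP/eqP => [/(congr1 (map_mx conjc))|->//]; rewrite !map_conjcK.
  apply: eq_big => [x|x _]; last by rewrite map_conjcZ conjc2V map_conjcK.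
  by apply/eqP/eqP => [->|<-]; rewrite map_conjcK.
- move=> a; rewrite mem_tsupp => /mapP[x xs ->].
  exact: (tclass_tsym sP xs).
- by move=> z _; rewrite gpoly_tsum tsum_tsym.
Qed.

End TermLists.

(** * Closure properties of the classes *)

Section Closure.
Variables (R : realType) (k m : nat).
Local Notation C := R[i].
Local Notation cpt := 'rV[R]_k.+2.

(** Complex-valued and without the symmetry condition of [P_class], so that closure is proved term
    by term; symmetry is restored at the end by [tsym]. *)
Definition vclass (n : nat) (mu : R) (F : cpt -> 'cV[C]_n) : Prop :=
  exists2 s : seq (term R n k), tclass m mu s &
    forall z, posz z -> F z = tsum s z.

Definition sclass (mu : R) (F : cpt -> C) : Prop :=
  exists2 s : seq ('rV[C]_k.+2 * C), (forall x, x \in s -> expo_class m mu x.1) &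
    forall z, posz z -> F z = \sum_(x <- s) zpow z x.1 * x.2.

Lemma vclass0 n mu : vclass mu (fun=> 0 : 'cV[C]_n).
Proof. by exists [::] => // z _; rewrite /tsum big_nil. Qed.

Lemma vclassD n mu (F F' : cpt -> 'cV[C]_n) :
  vclass mu F -> vclass mu F' -> vclass mu (fun z => F z + F' z).
Proof.
move=> [s sP sE] [s' sP' sE']; exists (s ++ s').
  by move=> x; rewrite mem_cat => /orP[/sP|/sP'].
by move=> z z0; rewrite sE// sE'// /tsum big_cat.
Qed.

Lemma vclass_sum n mu (I : Type) (r : seq I) (P : pred I) (F : I -> cpt -> 'cV[C]_n) :
  (forall i, P i -> vclass mu (F i)) ->
  vclass mu (fun z => \sum_(i <- r | P i) F i z).
Proof.
move=> HF; elim: r => [|i r IHr].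
  have [s sP sE] := vclass0 n mu; exists s => // z z0.
  by rewrite big_nil -sE.
case Pi : (P i).
  have [s sP sE] := vclassD (HF i Pi) IHr; exists s => // z z0.
  by rewrite big_cons Pi sE.
by have [s sP sE] := IHr; exists s => // z z0; rewrite big_cons Pi sE.
Qed.

Lemma vclassN n mu (F : cpt -> 'cV[C]_n) :
  vclass mu F -> vclass mu (fun z => - F z).
Proof.
move=> [s sP sE]; exists (tmap (fun _ x => - x) s); first exact: tclass_tmap.
by move=> z z0; rewrite sE// /tsum big_map -sumrN; apply: eq_bigr => x _; rewrite scalerN.
Qed.

Lemma sclass_vclass n mu nu (F : cpt -> C) (H : cpt -> 'cV[C]_n) :
  sclass mu F -> vclass nu H -> vclass (mu + nu) (fun z => F z *: H z).
Proof.
move=> [s sP sE] [s' sP' sE'].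
exists [seq (x.1 + y.1, x.2 *: y.2) | x <- s, y <- s'].
  move=> x /allpairsP[[y y'] [/= ys ys' ->]]/=.
  by apply: expo_classD; [exact: sP|exact: sP'].
move=> z z0; rewrite sE// sE'// /tsum big_allpairs_dep/= scaler_suml.
apply: eq_bigr => x _; rewrite scaler_sumr; apply: eq_bigr => y _.
by rewrite /= zpowD !scalerA; congr (_ *: _); ring.
Qed.

Lemma sclassM mu nu (F F' : cpt -> C) :
  sclass mu F -> sclass nu F' -> sclass (mu + nu) (fun z => F z * F' z).
Proof.
move=> [s sP sE] [s' sP' sE'].
exists [seq (x.1 + y.1, x.2 * y.2) | x <- s, y <- s'].
  move=> x /allpairsP[[y y'] [/= ys ys' ->]]/=.
  by apply: expo_classD; [exact: sP|exact: sP'].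
move=> z z0; rewrite sE// sE'// big_allpairs_dep/= mulr_suml.
apply: eq_bigr => x _; rewrite mulr_sumr; apply: eq_bigr => y _.
by rewrite /= zpowD; ring.
Qed.

Lemma sclass1 : sclass 0 (fun=> 1).
Proof.
exists [:: (0, 1)]; first by move=> x; rewrite inE => /eqP -> /=; exact: expo_class0.
by move=> z _; rewrite big_cons big_nil/= zpow0 mul1r addr0.
Qed.

Lemma sclass_prod (I : Type) (r : seq I) (mu : I -> R) (F : I -> cpt -> C) :
  (forall i, sclass (mu i) (F i)) ->
  sclass (\sum_(i <- r) mu i) (fun z => \prod_(i <- r) F i z).
Proof.
move=> HF; elim: r => [|i r IHr].
  rewrite big_nil; have [s sP sE] := sclass1; exists s => // z z0.
  by rewrite big_nil (sE z).
rewrite big_cons; have [s sP sE] := sclassM (HF i) IHr; exists s => // z z0.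
by rewrite big_cons sE.
Qed.

Lemma vclass_coord n mu (F : cpt -> 'cV[C]_n) i :
  vclass mu F -> sclass mu (fun z => F z i ord0).
Proof.
move=> [s sP sE]; exists [seq (x.1, (x.2 : 'cV[C]_n) i ord0) | x <- s].
  by move=> x /mapP[y ys ->]; exact: sP.
by move=> z z0; rewrite sE// /tsum big_map summxE; apply: eq_bigr => x _; rewrite mxE.
Qed.

Lemma vclass_cst n (c : 'cV[C]_n) : vclass 0 (fun=> c).
Proof.
exists [:: (0, c)]; first by move=> x; rewrite inE => /eqP -> /=; exact: expo_class0.
by move=> z _; rewrite /tsum big_cons big_nil/= zpow0 scale1r addr0.
Qed.

Lemma P_class_vclass n mu (p : cpt -> 'cV[R]_n) :
  P_class m mu p -> vclass mu (fun z => cplx (p z)).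
Proof.
move=> [S [xi [_ _ SP pE]]]; exists [seq (a, xi a) | a <- S].
  by move=> x /mapP[a aS ->]/=; exact: SP.
by move=> z z0; rewrite pE// /gpoly /tsum big_map.
Qed.

(** Expansion along the standard basis gives products of coordinates times constant vectors;
    exponents of a product add, hence so do the degrees. *)
Lemma vclass_multilinear n d (g : ('I_d -> 'cV[R]_n) -> 'cV[R]_n)
    (mu : 'I_d -> R) (v : 'I_d -> cpt -> 'cV[R]_n) : (0 < n)%N ->
  multilinear_map g ->
  (forall l, vclass (mu l) (fun z => cplx (v l z))) ->
  vclass (\sum_l mu l) (fun z => cplx (g (fun l => v l z))).
Proof.
move=> n0 g_lin Hv.
have : vclass (\sum_l mu l) (fun z => \sum_(j : {ffun 'I_d -> 'I_n})
    (\prod_l cplx (v l z) (j l) ord0) *: cplx (g (fun l => delta_mx (j l) ord0))).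
  apply: vclass_sum => j _; rewrite -[X in vclass X]addr0.
  apply: sclass_vclass; last exact: vclass_cst.
  by apply: sclass_prod => l; exact: vclass_coord.
move=> [s sP sE]; exists s => // z z0; rewrite -sE//.
rewrite (multilinear_basis g_lin (Ordinal n0)) /cplx raddf_sum/=.
apply: eq_bigr => j _; apply/matrixP => i l; rewrite !mxE rmorphM rmorph_prod/=.
by congr (_ * _); apply: eq_bigr => l' _; rewrite mxE.
Qed.

End Closure.

Lemma vclass_ztrunc (R : realType) (j k m n : nat) (mu : R)
    (F : 'rV[R]_j.+2 -> 'cV[R[i]]_n) : (j <= k)%N -> (m <= j)%N ->
  vclass m mu F -> vclass m mu (fun z : 'rV[R]_k.+2 => F (ztrunc j z)).
Proof.
move=> jk mj [s sP sE]; exists [seq (zext k x.1, x.2) | x <- s].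
  by move=> x /mapP[y ys ->]/=; apply: expo_class_zext => //; exact: sP.
move=> z z0; rewrite sE; last exact: posz_ztrunc.
by rewrite /tsum big_map; apply: eq_bigr => x _; rewrite zpow_ztrunc.
Qed.

(** * Iterated logarithms *)

Section IteratedLogarithms.
Variable R : realType.

Lemma near_iterlog_ge (m : nat) (c : R) : \forall t \near +oo_R, c <= iterlog m t.
Proof.
elim: m c => [|m IH] c; first by apply: nbhs_pinfty_ge; exact: num_real.
near=> t; rewrite /= -[leLHS]expRK ler_ln ?posrE ?expR_gt0//.
  by near: t; exact: IH.
by apply: lt_le_trans (expR_gt0 c) _; near: t; exact: IH.
Unshelve. all: by end_near. Qed.

Lemma near_iterlog_gt0 (m : nat) : \forall t \near +oo_R, 0 < iterlog m t.
Proof.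
near=> t; apply: lt_le_trans (ltr01) _; near: t; exact: near_iterlog_ge.
Unshelve. all: by end_near. Qed.

Lemma near_iterlogs_ge1 (k : nat) :
  \forall t \near +oo_R, forall l, (l <= k)%N -> 1 <= iterlog l t.
Proof.
elim: k => [|k IH].
  by near=> t => l; rewrite leqn0 => /eqP ->; near: t; exact: near_iterlog_ge.
near=> t => l; rewrite leq_eqVlt => /orP[/eqP ->|].
  by near: t; exact: near_iterlog_ge.
by rewrite ltnS; move: l; near: t.
Unshelve. all: by end_near. Qed.

(** From the threshold on, (e x)^2 / 2 is at least x, and exp(e x) dominates it. *)
Lemma ln_le_eps (e x : R) : 0 < e -> 2 / e ^+ 2 <= x -> ln x <= e * x.
Proof.
move=> e0 ex; have x0 : 0 < x.
  by apply: lt_le_trans ex; rewrite divr_gt0// exprn_gt0.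
rewrite -[leRHS]expRK ler_ln ?posrE ?expR_gt0//.
have ex0 : 0 <= e * x by rewrite mulr_ge0 ?ltW.
apply: le_trans (expR_ge1Dxn 1 ex0).
have : x <= (e * x) ^+ 2 / 2.
  move: ex; rewrite ler_pdivrMr ?exprn_gt0// => ex.
  have := ler_wpM2r (ltW x0) ex; rewrite exprMn; lra.
by rewrite (_ : 2`!%:R = 2 :> R)//; lra.
Qed.

Lemma near_iterlog_le_eps (m i : nat) (e : R) : (m < i)%N -> 0 < e ->
  \forall t \near +oo_R, iterlog i t <= e * iterlog m t.
Proof.
move=> + e0; elim: i => // i IH; rewrite ltnS leq_eqVlt => /orP[/eqP <-|mi].
  by near=> t; apply: ln_le_eps => //; near: t; exact: near_iterlog_ge.
have {}IH := IH mi; near=> t.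
apply: (@le_trans _ _ (iterlog i t)); last by near: t.
by rewrite /= ltW// ln_sublinear//; near: t; exact: near_iterlog_gt0.
Unshelve. all: by end_near. Qed.

(** The derivative of L_m, equal to 1 for m = 0. *)
Definition dlog (m : nat) (t : R) : R := \prod_(l < m) (iterlog l t)^-1.

Lemma is_derive_iterlog (m : nat) (t : R) :
  (forall l, (l < m)%N -> 0 < iterlog l t) ->
  is_derive t (1 : R) (@iterlog R m) (dlog m t).
Proof.
elim: m => [_|m IH Ht]; first by rewrite /dlog big_ord0; exact: is_derive_id.
rewrite /dlog big_ord_recr/= mulrC.
apply: (@is_derive1_comp _ (@ln R) (iterlog m)).
  by apply: is_derive1_ln; exact: Ht.
by apply: IH => l lm; apply: Ht; rewrite ltnS ltnW.
Qed.

Lemma dlog_le_inv (m : nat) (t : R) :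
  (forall l, (l <= m)%N -> 1 <= iterlog l t) -> 0 <= dlog m.+1 t <= t^-1.
Proof.
move=> L1; have L0 l : (l <= m)%N -> 0 < iterlog l t.
  by move=> /L1; apply: lt_le_trans.
apply/andP; split.
  by apply: prodr_ge0 => l _; rewrite invr_ge0 ltW// L0// -ltnS.
rewrite /dlog big_ord_recl -[leRHS]mulr1; apply: (ler_wpM2l (x := t^-1)).
  by rewrite invr_ge0 ltW// (L0 0%N).
apply: prodr_ile1 => i _; have im : (lift ord0 i <= m)%N.
  by rewrite -ltnS ltn_ord.
by rewrite invr_ge0 (ltW (L0 _ im)) invf_le1 ?L0// L1.
Qed.

(** The logarithmic derivative of L_m^nu is nu times this derivative of L_(m+1); its decay to 0 is
    the slow variation of the comparison function. *)
Lemma near_dlog (m : nat) (e : R) : 0 < e -> \forall t \near +oo_R,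
  0 <= dlog m.+1 t <= e.
Proof.
move=> e0; near=> t.
have /dlog_le_inv/andP[-> d] : forall l, (l <= m)%N -> 1 <= iterlog l t.
  by near: t; exact: near_iterlogs_ge1.
have t0 : 0 < t by near: t; exact: (near_iterlog_gt0 0).
by apply: le_trans d _; rewrite invf_ple ?posrE//.
Unshelve. all: by end_near. Qed.

(* L_m(t)^nu, once L_m(t) > 0 *)
Definition lpow (m : nat) (nu t : R) : R := expR (nu * iterlog m.+1 t).

Lemma lpow_gt0 m nu t : 0 < lpow m nu t. Proof. exact: expR_gt0. Qed.

Lemma lpow_ge0 m nu t : 0 <= lpow m nu t. Proof. exact: expR_ge0. Qed.

Lemma near_powR_lpow m nu : \forall t \near +oo_R, iterlog m t `^ nu = lpow m nu t.
Proof.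
near=> t; rewrite /powR gt_eqF//; near: t; exact: near_iterlog_gt0.
Unshelve. all: by end_near. Qed.

Lemma near_lpow_le m nu nu' : nu <= nu' ->
  \forall t \near +oo_R, lpow m nu t <= lpow m nu' t.
Proof.
move=> nn; near=> t; rewrite ler_expR ler_wpM2r// ltW//.
by near: t; exact: near_iterlog_gt0.
Unshelve. all: by end_near. Qed.

Lemma lpowD m nu nu' t : lpow m (nu + nu') t = lpow m nu t * lpow m nu' t.
Proof. by rewrite /lpow mulrDl expRD. Qed.

Lemma near_lpow_eps m nu e : nu < 0 -> 0 < e ->
  \forall t \near +oo_R, lpow m nu t <= e.
Proof.
move=> nu0 e0; near=> t; rewrite -[leRHS]lnK ?posrE// ler_expR.
rewrite mulrC -ler_ndivrMr//; near: t; exact: near_iterlog_ge.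
Unshelve. all: by end_near. Qed.

Lemma is_derive_lpow m nu (t : R) : (forall l, (l <= m)%N -> 0 < iterlog l t) ->
  is_derive t (1 : R) (lpow m nu) (nu * dlog m.+1 t * lpow m nu t).
Proof.
move=> Ht; rewrite mulrC; apply: (@is_derive1_comp _ (@expR R)).
by apply: is_derive_mull; exact: is_derive_iterlog.
Qed.

Lemma near_inv_lpow0 nu : \forall t \near +oo_R,
  t^-1 * lpow 0 nu t = lpow 0 (nu - 1) t.
Proof.
near=> t; rewrite lpowD mulrC; congr (_ * _).
rewrite /lpow mulN1r expRN lnK// posrE; near: t; exact: (near_iterlog_gt0 0).
Unshelve. all: by end_near. Qed.

(** Both sides are exponentials, and L_(m+2) is o(ln t). So 1/t beats every power of L_(m+1), which
    is why no correction chi_k appears in case (ii). *)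
Lemma near_inv_lpowS m nu nu' : \forall t \near +oo_R,
  t^-1 * lpow m.+1 nu t <= lpow m.+1 nu' t.
Proof.
pose e := (1 + `|nu - nu'|)^-1.
have d0 : 0 < 1 + `|nu - nu'| by rewrite ltr_pwDl.
have e0 : 0 < e by rewrite invr_gt0.
near=> t.
have t0 : 0 < t by near: t; exact: (near_iterlog_gt0 0).
have -> : t^-1 = expR (- ln t) by rewrite expRN lnK.
rewrite -expRD ler_expR.
have L0 : 0 < iterlog m.+2 t by near: t; exact: near_iterlog_gt0.
have Le : iterlog m.+2 t <= e * iterlog 1 t by near: t; exact: near_iterlog_le_eps.
have : (1 + `|nu - nu'|) * iterlog m.+2 t <= ln t.
  by rewrite mulrC -ler_pdivlMr// mulrC.
have : (nu - nu') * iterlog m.+2 t <= `|nu - nu'| * iterlog m.+2 t.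
  by rewrite ler_wpM2r ?ler_norm// ltW.
move: (iterlog m.+2 t) L0 (ln t) => L L0 l; lra.
Unshelve. all: by end_near. Qed.

End IteratedLogarithms.

(** * Size and derivative of power functions along the iterated logarithms *)

Section AlongLhat.
Variable R : realType.
Local Notation C := R[i].
Local Notation Re := (@complex.Re R).
Local Notation Im := (@complex.Im R).

Definition cnorm (n : nat) (x : 'cV[C]_n) : R :=
  \sum_i (`|Re (x i ord0)| + `|Im (x i ord0)|).

Lemma cnorm_ge0 n (x : 'cV[C]_n) : 0 <= cnorm x.
Proof. by apply: sumr_ge0 => i _; rewrite addr_ge0. Qed.

Lemma cnormD n (x y : 'cV[C]_n) : cnorm (x + y) <= cnorm x + cnorm y.
Proof.
rewrite -big_split/=; apply: ler_sum => i _; rewrite mxE complex_ReD complex_ImD.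
have := ler_normD (Re (x i ord0)) (Re (y i ord0)).
have := ler_normD (Im (x i ord0)) (Im (y i ord0)); lra.
Qed.

Lemma cnorm0 n : cnorm (0 : 'cV[C]_n) = 0.
Proof. by apply: big1 => i _; rewrite mxE !normr0 addr0. Qed.

Lemma cnorm_sum n (I : Type) (r : seq I) (P : pred I) (F : I -> 'cV[C]_n) :
  cnorm (\sum_(i <- r | P i) F i) <= \sum_(i <- r | P i) cnorm (F i).
Proof.
elim/big_ind2 : _ => [|x a y b xa yb|//]; first by rewrite cnorm0.
by apply: le_trans (cnormD _ _) _; exact: lerD.
Qed.

Lemma cnormZ n (c : C) (x : 'cV[C]_n) :
  cnorm (c *: x) <= (`|Re c| + `|Im c|) * cnorm x.
Proof.
rewrite mulr_sumr; apply: ler_sum => i _; rewrite mxE complex_ReM complex_ImM.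
have := ler_normB (Re c * Re (x i ord0)) (Im c * Im (x i ord0)).
have := ler_normD (Re c * Im (x i ord0)) (Im c * Re (x i ord0)).
rewrite !normrM; lra.
Qed.

Lemma norm_map_Re n (x : 'cV[C]_n) : `|map_mx Re x| <= cnorm x.
Proof.
apply: norm_le_coord => [|i j]; first exact: cnorm_ge0.
rewrite mxE (ord1 j) /cnorm (bigD1 i)//= -addrA lerDl addr_ge0//.
by apply: sumr_ge0 => l _; rewrite addr_ge0.
Qed.

Lemma cexp_bound (c : C) : `|Re (cexp c)| + `|Im (cexp c)| <= 2 * expR (Re c).
Proof.
rewrite /cexp complex_ReM complex_ImM/= !mul0r subr0 addr0 !normrM ger0_norm ?expR_ge0//.
have Hc : `|cos (Im c)| <= 1 by rewrite ler_norml cos_geN1 cos_le1.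
have Hs : `|sin (Im c)| <= 1 by rewrite ler_norml sin_geN1 sin_le1.
rewrite -mulrDr mulrC ler_wpM2r ?expR_ge0//; lra.
Qed.

Lemma zpow_Lhat (k : nat) (t : R) (a : 'rV[C]_k.+2) :
  zpow (Lhat k t) a = cexp (\sum_i a ord0 i * real_complex R (iterlog i t)).
Proof.
rewrite cexp_sum; apply: eq_bigr => i _; rewrite mxE /cpow.
by case: i => [[|i] ik]//=; rewrite expRK.
Qed.

Lemma ztrunc_Lhat (j k : nat) (t : R) : (j <= k)%N ->
  ztrunc j (Lhat k t) = Lhat j t.
Proof.
move=> jk; apply/rowP => i; rewrite !mxE inordK//.
by apply: leq_trans (ltn_ord i) _.
Qed.

Lemma posz_Lhat (k : nat) (t : R) : (forall l, (l <= k)%N -> 0 < iterlog l t) ->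
  posz (Lhat k t).
Proof.
move=> Ht [[|i] ik]; rewrite mxE/=; first exact: expR_gt0.
by apply: Ht; rewrite -ltnS.
Qed.

(** The logarithm of the modulus is the sum of the Re a_i L_i. Entries before position m + 1 are
    imaginary, that position gives mu L_(m+1), and later ones are o(L_(m+1)) with arbitrary sign,
    hence the strict inequality mu < nu. *)
Lemma near_expo_class (k m : nat) (mu nu : R) (a : 'rV[C]_k.+2) : (m <= k)%N ->
  expo_class m mu a -> mu < nu ->
  \forall t \near +oo_R, `|Re (zpow (Lhat k t) a)| + `|Im (zpow (Lhat k t) a)| <=
    2 * lpow m nu t.
Proof.
move=> mk Ha munu.
(* The slack nu - mu is shared equally among the k + 2 positions. *)
have [e eE e0] : exists2 e, e * k.+2%:R = nu - mu & 0 < e.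
  exists ((nu - mu) / k.+2%:R); first by rewrite divfK ?pnatr_eq0.
  by rewrite divr_gt0// subr_gt0.
have H (i : 'I_k.+2) : \forall t \near +oo_R, Re (a ord0 i) * iterlog i t <=
    (if i == m.+1 :> nat then mu else 0) * iterlog m.+1 t + e * iterlog m.+1 t.
  have [a1 a2] := Ha i; case: (ltngtP i m.+1) => im.
  - near=> t; rewrite a1// !mul0r add0r mulr_ge0 ?(ltW e0)// ltW//.
    by near: t; exact: near_iterlog_gt0.
  - pose r := Re (a ord0 i).
    have r0 : 0 < 1 + `|r| by rewrite ltr_pwDl.
    have er0 : 0 < e / (1 + `|r|) by rewrite divr_gt0.
    near=> t; rewrite mul0r add0r -/r.
    have L0 : 0 < iterlog i t by near: t; exact: near_iterlog_gt0.
    have Le : iterlog i t <= e / (1 + `|r|) * iterlog m.+1 t.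
      by near: t; exact: near_iterlog_le_eps.
    apply: (@le_trans _ _ ((1 + `|r|) * iterlog i t)).
      rewrite ler_wpM2r ?(ltW L0)//; have := ler_norm r; lra.
    by rewrite mulrC -ler_pdivlMr// mulrAC.
  - near=> t; rewrite a2// im lerDl mulr_ge0 ?(ltW e0)// ltW//.
    by near: t; exact: near_iterlog_gt0.
have {}H := filter_forall _ H.
near=> t; rewrite zpow_Lhat; apply: le_trans (cexp_bound _) _.
rewrite ler_pM2l// ler_expR complex_Re_sum.
have : forall i : 'I_k.+2, Re (a ord0 i) * iterlog i t <=
    (if i == m.+1 :> nat then mu else 0) * iterlog m.+1 t + e * iterlog m.+1 t.
  by near: t; exact: H.
move=> Ht; under eq_bigr do rewrite complex_ReM/= mulr0 subr0.
apply: le_trans (ler_sum _ (fun i _ => Ht i)) _.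
rewrite big_split/= -!mulr_suml sumr_const card_ord.
have mk2 : (m.+1 < k.+2)%N by [].
rewrite (bigD1 (Ordinal mk2))//= eqxx big1 ?addr0 => [|i im]; last first.
  by case: eqP => // im'; move/eqP: im; case; exact: val_inj.
rewrite -[e *+ _]mulr_natr eE; lra.
Unshelve. all: by end_near. Qed.

Lemma near_tsum_bound (n k m : nat) (mu nu : R) (s : seq (term R n k)) :
  (m <= k)%N -> tclass m mu s -> mu < nu ->
  exists2 K : R, 0 <= K & \forall t \near +oo_R,
    cnorm (tsum s (Lhat k t)) <= K * lpow m nu t.
Proof.
move=> mk + munu; elim: s => [_|x s IH sP].
  exists 0 => //; near=> t; rewrite /tsum big_nil cnorm0 mul0r//.
have [|K K0 HK] := IH; first by move=> y ys; apply: sP; rewrite inE ys orbT.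
have Hx := near_expo_class mk (sP _ (mem_head _ _)) munu.
exists (2 * cnorm x.2 + K); first by rewrite addr_ge0// mulr_ge0 ?cnorm_ge0.
near=> t; rewrite /tsum big_cons; apply: le_trans (cnormD _ _) _.
rewrite mulrDl; apply: lerD; last by near: t.
apply: le_trans (cnormZ _ _) _; rewrite mulrAC ler_wpM2r ?cnorm_ge0//.
by near: t.
Unshelve. all: by end_near. Qed.

Definition tM (n k : nat) (p : 'I_k.+2) (s : seq (term R n k)) :=
  tmap (fun a x => a ord0 p *: x) s.

Definition tR (n k : nat) (s : seq (term R n k)) (z : 'rV[R]_k.+2) : 'cV[C]_n :=
  \sum_(j < k.+1)
    real_complex R (\prod_(l < k.+1 | (l <= j)%N) (z ord0 (lift ord0 l))^-1) *:
      tsum (tM (lift ord0 j) s) z.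

Lemma calR_tsupp (n k : nat) (s : seq (term R n k)) z :
  calR (tsupp s) (tcoef s) z = tR s z.
Proof.
apply: eq_bigr => j _; congr (_ *: _); rewrite /calM.
rewrite (@gpoly_tsupp _ _ _ (fun a x => a ord0 (lift ord0 j) *: x))// => a.
  exact: scaler0.
by move=> x y; rewrite scalerDr.
Qed.

Lemma tsum_tM_tsym (n k : nat) p (s : seq (term R n k)) z :
  tsum (tM p (tsym s)) z = cplx (treal (tM p s) z).
Proof.
rewrite -tsum_tsym /tM tsym_tmap// => a; last by move=> x; rewrite map_conjcZ mxE.
by move=> c x; rewrite !scalerA mulrC.
Qed.

Lemma map_Re_cplx (n : nat) (x : 'cV[R]_n) : map_mx Re (cplx x) = x.
Proof. by apply/matrixP => i j; rewrite !mxE. Qed.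

Lemma tR_tsym (n k : nat) (s : seq (term R n k)) z :
  tR (tsym s) z = cplx (map_mx Re (tR s z)).
Proof.
have -> : map_mx Re (tR s z) = \sum_(j < k.+1)
    (\prod_(l < k.+1 | (l <= j)%N) (z ord0 (lift ord0 l))^-1) *:
      treal (tM (lift ord0 j) s) z.
  apply/matrixP => i j; rewrite mxE !summxE complex_Re_sum; apply: eq_bigr => l _.
  by rewrite !mxE complex_ReM/= mul0r subr0.
rewrite /tR /cplx raddf_sum; apply: eq_bigr => j _.
by rewrite tsum_tM_tsym [RHS]map_mxZ.
Qed.

Lemma prod_Lhat_dlog (k : nat) (t : R) (j : 'I_k.+1) :
  \prod_(l < k.+1 | (l <= j)%N) (Lhat k t ord0 (lift ord0 l))^-1 = dlog j.+1 t.
Proof.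
rewrite /dlog (big_ord_widen k.+1 (fun l => (iterlog l t)^-1))//.
by apply: eq_big => [l|l _]; rewrite ?ltnS// mxE.
Qed.

(** Along [Lhat] the logarithm of the entry at position p is L_p(t), so the logarithmic derivative
    of z^a is the sum of the a_p times the derivatives of L_p: position 0 yields M_(-1), the others
    yield R. *)
Lemma tM_tR_Lhat (n k : nat) (s : seq (term R n k)) (t : R) :
  tsum (tM ord0 s) (Lhat k t) + tR s (Lhat k t) =
  \sum_(x <- s) ((\sum_p x.1 ord0 p * real_complex R (dlog p t)) *
    zpow (Lhat k t) x.1) *: x.2.
Proof.
rewrite /tR; under eq_bigr do rewrite prod_Lhat_dlog /tsum big_map scaler_sumr.
rewrite exchange_big/= /tsum big_map -big_split/=; apply: eq_bigr => x _.
rewrite [in RHS]big_ord_recl/= mulrDl scalerDl; congr (_ + _).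
  by rewrite /dlog big_ord0 scalerA mulr1 mulrC.
rewrite mulr_suml scaler_suml; apply: eq_bigr => j _; rewrite !scalerA.
by congr (_ *: _); rewrite /bump/= ?add1n; ring.
Qed.

(** With exponent X + i Y the real part is e^X times a combination of cos Y and sin Y, which reduces
    the claim to real derivatives. *)
Lemma is_derive_zpow_Lhat (k : nat) (t : R) (a : 'rV[C]_k.+2) (c : C) :
  (forall l, (l <= k)%N -> 0 < iterlog l t) ->
  is_derive t (1 : R) (fun u => Re (zpow (Lhat k u) a * c))
    (Re ((\sum_p a ord0 p * real_complex R (dlog p t)) * zpow (Lhat k t) a * c)).
Proof.
move=> Ht.
pose X u := \sum_i Re (a ord0 i) * iterlog i u.
pose Y u := \sum_i Im (a ord0 i) * iterlog i u.
pose dX := \sum_i Re (a ord0 i) * dlog i t.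
pose dY := \sum_i Im (a ord0 i) * dlog i t.
have HL (i : 'I_k.+2) : is_derive t (1 : R) (@iterlog R i) (dlog i t).
  apply: is_derive_iterlog => l li; apply: Ht.
  by rewrite -ltnS -ltnS (leq_ltn_trans li).
have HX : is_derive t (1 : R) X dX.
  by apply: is_derive_sum_fun => i; exact: is_derive_mull.
have HY : is_derive t (1 : R) Y dY.
  by apply: is_derive_sum_fun => i; exact: is_derive_mull.
have E u : \sum_i a ord0 i * real_complex R (iterlog i u) = Complex (X u) (Y u).
  apply/eqP; rewrite eq_complex complex_Re_sum complex_Im_sum/=; apply/andP; split; apply/eqP;
  by apply: eq_bigr => i _; rewrite ?complex_ReM ?complex_ImM/= mulr0 ?subr0 ?add0r.
have -> : \sum_p a ord0 p * real_complex R (dlog p t) = Complex dX dY.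
  apply/eqP; rewrite eq_complex complex_Re_sum complex_Im_sum/=; apply/andP; split; apply/eqP;
  by apply: eq_bigr => i _; rewrite ?complex_ReM ?complex_ImM/= mulr0 ?subr0 ?add0r.
rewrite zpow_Lhat E.
rewrite (_ : (fun u => _) = fun u =>
    expR (X u) * (Re c * cos (Y u) - Im c * sin (Y u))); last first.
  apply/funext => u; rewrite zpow_Lhat E /cexp !(complex_ReM, complex_ImM)/=; ring.
have He : is_derive t (1 : R) (fun u => expR (X u)) (expR (X t) * dX).
  exact: (@is_derive1_comp _ (@expR R) X).
have Hc : is_derive t (1 : R) (fun u => cos (Y u)) (- sin (Y t) * dY).
  exact: (@is_derive1_comp _ (@cos R) Y).
have Hs : is_derive t (1 : R) (fun u => sin (Y u)) (cos (Y t) * dY).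
  exact: (@is_derive1_comp _ (@sin R) Y).
apply: is_derive_eq (is_derive_mul He (is_deriveB (is_derive_mull (Re c) Hc)
  (is_derive_mull (Im c) Hs))) _.
by rewrite /cexp !(complex_ReM, complex_ImM)/= !fctE; ring.
Qed.

Lemma is_derive_treal (n k : nat) (s : seq (term R n k)) (t : R) (i : 'I_n) :
  (forall l, (l <= k)%N -> 0 < iterlog l t) ->
  is_derive t (1 : R) (fun u => treal s (Lhat k u) i ord0)
    (map_mx Re (tsum (tM ord0 s) (Lhat k t) + tR s (Lhat k t)) i ord0).
Proof.
move=> Ht; rewrite tM_tR_Lhat.
rewrite (_ : (fun u => _) = fun u =>
    \sum_(x <- s) Re (zpow (Lhat k u) x.1 * x.2 i ord0)); last first.
  apply/funext => u; rewrite mxE summxE complex_Re_sum; apply: eq_bigr => x _.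
  by rewrite mxE.
rewrite mxE summxE complex_Re_sum; under eq_bigr do rewrite mxE.
elim: s => [|x s IH].
  rewrite (_ : (fun u => _) = cst 0) ?big_nil; first exact: is_derive_cst.
  by apply/funext => u; rewrite big_nil.
rewrite big_cons (_ : (fun u => _) = (fun u => Re (zpow (Lhat k u) x.1 * x.2 i ord0)) +
  (fun u => \sum_(x <- s) Re (zpow (Lhat k u) x.1 * x.2 i ord0))).
  by apply: is_deriveD IH; exact: is_derive_zpow_Lhat.
by apply/funext => u; rewrite big_cons fctE.
Qed.

(** Each weight in R is the derivative of some L_(j+1), at most 1/t, and the operators M_j leave the
    exponents unchanged. *)
Lemma near_tR_bound (n k m : nat) (mu nu : R) (s : seq (term R n k)) :
  (m <= k)%N -> tclass m mu s -> mu < nu ->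
  exists2 K : R, 0 <= K & \forall t \near +oo_R,
    cnorm (tR s (Lhat k t)) <= K * (t^-1 * lpow m nu t).
Proof.
move=> mk sP munu.
have H (j : 'I_k.+1) : {K : R | 0 <= K & \forall t \near +oo_R,
    cnorm (tsum (tM (lift ord0 j) s) (Lhat k t)) <= K * lpow m nu t}.
  by apply: cid2; apply: (near_tsum_bound mk _ munu); apply: tclass_tmap.
exists (\sum_j s2val (H j)); first by apply: sumr_ge0 => j _; exact: s2valP (H j).
have {}HK : forall j, \forall t \near +oo_R,
    cnorm (tsum (tM (lift ord0 j) s) (Lhat k t)) <= s2val (H j) * lpow m nu t.
  by move=> j; exact: s2valP' (H j).
have K0 j : 0 <= s2val (H j) by exact: s2valP (H j).
have {}HK := filter_forall _ HK.
near=> t; apply: le_trans (cnorm_sum _ _ _) _; rewrite mulr_suml.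
have L1 : forall l, (l <= k)%N -> 1 <= iterlog l t.
  by near: t; exact: near_iterlogs_ge1.
apply: ler_sum => j _; apply: le_trans (cnormZ _ _) _; rewrite /= normr0 addr0.
rewrite prod_Lhat_dlog [leRHS]mulrCA; apply: ler_pM => //.
- exact: cnorm_ge0.
- have /dlog_le_inv/andP[d0 d1] : forall l, (l <= j)%N -> 1 <= iterlog l t.
    by move=> l lj; apply: L1; rewrite (leq_trans lj)// -ltnS.
  by rewrite ger0_norm.
- by move: j; near: t; exact: HK.
Unshelve. all: by end_near. Qed.

End AlongLhat.

(** * Construction of the expansion *)

(** Course-of-values recursion for values of varying type (q_k has n_k + 2 variables), each given
    only by existence once the earlier ones satisfy P. Q takes a whole family as argument; the
    second premise says that it reads only the entries before k. *)
Lemma dependent_recursion (T : nat -> Type) (d : forall k, T k)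
    (P : forall k, T k -> Prop) (Q : forall k, (forall j, T j) -> T k -> Prop) :
  (forall k h, (forall j, (j < k)%N -> P j (h j)) ->
     exists v, P k v /\ Q k h v) ->
  (forall k h h' v, (forall j, (j < k)%N -> h j = h' j) -> Q k h v -> Q k h' v) ->
  exists q, forall k, P k (q k) /\ Q k q (q k).
Proof.
move=> ex loc.
have F k (h : forall j, T j) :
    {v | (forall j, (j < k)%N -> P j (h j)) -> P k v /\ Q k h v}.
  apply: cid; case: (pselect (forall j, (j < k)%N -> P j (h j))) => H.
    by have [v Hv] := ex k h H; exists v.
  by exists (d k) => /H.
(* Entries from k on are reset to the default, so that the value chosen at k depends on earlier
   entries only. *)
pose trunc k (h : forall j, T j) j := if (j < k)%N then h j else d j.
have trunc_eq k h h' : (forall j, (j < k)%N -> h j = h' j) -> trunc k h = trunc k h'.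
  by move=> hh; apply: functional_extensionality_dep => j; rewrite /trunc; case: ifP => [/hh|].
(* Successive approximations: entry k of [H i] is final as soon as k < i, so the diagonal [H k.+1 k]
   is the solution. *)
pose H := fix H i : forall j, T j :=
  if i is i'.+1 then fun k => sval (F k (trunc k (H i'))) else d.
have stab k i i' : (k < i)%N -> (k < i')%N -> H i k = H i' k.
  elim/ltn_ind: k i i' => k IH [//|i] [//|i'] ki ki' /=.
  suff -> : trunc k (H i) = trunc k (H i') by [].
  by apply: trunc_eq => j jk; apply: IH => //; exact: leq_trans jk _.
exists (fun k => H k.+1 k).
have E k : H k.+1 k = sval (F k (trunc k (fun j => H j.+1 j))).
  rewrite [LHS]/=; suff -> : trunc k (H k) = trunc k (fun j => H j.+1 j) by [].
  by apply: trunc_eq => j jk; apply: stab.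
elim/ltn_ind => k IH; rewrite E.
case: (F k _) => v /= []; first by move=> j jk; rewrite /trunc jk; case: (IH j jk).
move=> Pv Qv; split => //; apply: loc Qv => j jk; by rewrite /trunc jk.
Qed.

Section Construction.
Variables (R : realType) (n : nat) (A : 'M[R]_n).
Hypothesis n_gt0 : (0 < n)%N.
Hypothesis A_spec : forall l : R[i], eigenvalue (cplx A) l -> 0 < complex.Re l.
Local Notation C := R[i].
Local Notation Re := (@complex.Re R).

(** Otherwise - a would be an eigenvalue of A with real part 0. *)
Lemma unitmx_shift (a : C) : Re a = 0 -> cplx A + a%:M \in unitmx.
Proof.
move=> a0; case: (boolP (_ \in unitmx)) => // nu.
have : eigenvalue (cplx A) (- a).
  apply: eigenvalue_det; rewrite raddfN/= opprK.
  by move: nu; rewrite unitmxE unitfE negbK => /eqP.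
by move=> /A_spec; case: a a0 {nu} => p q /= ->; rewrite oppr0 ltxx.
Qed.

Definition Zop (k : nat) (a : 'rV[C]_k.+2) (x : 'cV[C]_n) : 'cV[C]_n :=
  invmx (cplx A + (a ord0 ord0)%:M) *m x.

Lemma Zop_conj k (a : 'rV[C]_k.+2) x :
  Zop (map_mx conjc a) (map_mx conjc x) = map_mx conjc (Zop a x).
Proof.
rewrite /Zop map_mxM map_invmx map_mxD map_scalar_mx mxE; congr (invmx (_ + _) *m _).
by apply/matrixP => i j; rewrite !mxE; exact/esym/conjc_real.
Qed.

(** Since F is real, the symmetrised list represents it as well, and Z_A commutes with
    symmetrisation because A is real. *)
Lemma is_calZ_treal (k m : nat) (mu : R) (s : seq (term R n k))
    (F : 'rV[R]_k.+2 -> 'cV[C]_n) :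
  tclass m mu s ->
  (forall z, posz z -> F z = tsum s z) ->
  (forall z, posz z -> F z = cplx (map_mx Re (F z))) ->
  is_calZ A F (fun z => cplx (treal (tmap (@Zop k) s) z)).
Proof.
move=> sP sE Freal; exists (tsupp (tsym s)), (tcoef (tsym s)); split.
- move=> a; rewrite mem_tsupp => /mapP[x xs ->].
  by have [H _] := tclass_tsym sP xs ord0; exact: H.
- by move=> z z0; rewrite gpoly_tsum tsum_tsym /treal -sE//; exact: Freal.
- move=> z z0; rewrite /calZ (@gpoly_tsupp _ _ _ (@Zop k)).
  + rewrite -tsym_tmap ?tsum_tsym//; last exact: Zop_conj.
    by move=> a c x; rewrite /Zop -scalemxAr.
  + by move=> a; rewrite /Zop mulmx0.
  + by move=> a x y; rewrite /Zop mulmxDr.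
Qed.

Lemma tM_Zop (k m : nat) (mu : R) (s : seq (term R n k)) z :
  tclass m mu s ->
  map_mx Re (tsum (tM ord0 (tmap (@Zop k) s)) z) =
  - (A *m treal (tmap (@Zop k) s) z) + treal s z.
Proof.
move=> sP.
have E : tsum (tM ord0 (tmap (@Zop k) s)) z =
    - (cplx A *m tsum (tmap (@Zop k) s) z) + tsum s z.
  rewrite /tsum !big_map/= mulmx_sumr -sumrN -big_split/= big_seq [RHS]big_seq.
  apply: eq_bigr => x xs.
  have a0 : Re (x.1 ord0 ord0) = 0 by have [H _] := sP _ xs ord0; exact: H.
  have xE := mulKVmx (unitmx_shift a0) x.2.
  rewrite -scalemxAr -scalerN -scalerDr -{3}xE mulmxDl -/(Zop x.1 x.2).
  by rewrite mul_scalar_mx addKr.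
rewrite E; apply/matrixP => i j.
rewrite /treal !mxE complex_ReD; congr (_ + _).
transitivity (- Re ((cplx A *m tsum (tmap (@Zop k) s) z) i j)).
  by rewrite !mxE; case: (\sum_ _ _).
rewrite mxE complex_Re_sum; congr (- _); apply: eq_bigr => l _.
by rewrite !mxE complex_ReM/= mul0r subr0.
Qed.

Variables (m : nat) (mu : nat -> R) (nn : nat -> nat) (b : bool).
Variable calG : forall d : nat, ('I_d -> 'cV[R]_n) -> 'cV[R]_n.
Hypothesis calG_lin : forall d, (2 <= d)%N -> multilinear_map (@calG d).
Hypothesis mu_gt0 : forall k, 0 < mu k.
Hypothesis mu_inc : forall j k, (j < k)%N -> mu j < mu k.
Hypothesis nn_inc : forall k, (nn k <= nn k.+1)%N.
Hypothesis nn_ge : forall k, (m <= nn k)%N.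
Hypothesis bm : b -> m = 0%N.
Variable p : forall k, 'rV[R]_(nn k).+2 -> 'cV[R]_n.
Hypothesis p_class : forall k, P_class m (- mu k) (@p k).

Lemma nn_le j k : (j <= k)%N -> (nn j <= nn k)%N.
Proof. exact: (homo_leq leqnn leq_trans nn_inc). Qed.

Local Notation T k := (seq (term R n (nn k))).

(* [b] selects the presence of the correction terms chi_k of case (i). *)
Definition chi_sum (h : forall k, T k) (k : nat) (z : 'rV[R]_(nn k).+2) : 'cV[C]_n :=
  \sum_(l < k | b && (mu l + 1 == mu k)) tR (tsym (h l)) (ztrunc (nn l) z).

Definition rhs (h : forall k, T k) (k : nat) (z : 'rV[R]_(nn k).+2) : 'cV[C]_n :=
  cplx (nonlinear_sum mu calG (fun k => treal (h k)) z + p z) - chi_sum h z.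

Lemma chi_sum_real h k (z : 'rV[R]_(nn k).+2) :
  chi_sum h z = cplx (\sum_(l < k | b && (mu l + 1 == mu k))
    map_mx Re (tR (h l) (ztrunc (nn l) z))).
Proof.
by rewrite /cplx raddf_sum; apply: eq_bigr => l _; rewrite [LHS]tR_tsym.
Qed.

Lemma vclass_tR k nu (s : seq (term R n k)) : m = 0%N -> tclass m nu s ->
  vclass m (nu - 1) (tR s).
Proof.
move=> m0 sP; rewrite addrC.
have : vclass m (-1 + nu) (fun z => \sum_(j < k.+1)
   zpow z (\row_i (if (0 < i <= j.+1)%N then -1 else 0)) *:
      tsum (tM (lift ord0 j) s) z).
  apply: vclass_sum => j _; apply: sclass_vclass; last first.
    by exists (tM (lift ord0 j) s) => //; exact: tclass_tmap.
  exists [:: (\row_i (if (0 < i <= j.+1)%N then -1 else 0), 1)].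
    by move=> x; rewrite inE => /eqP -> /=; rewrite m0; exact: expo_class_inv_prod.
  by move=> z z0; rewrite big_cons big_nil/= mulr1 addr0.
move=> [s' sP' sE']; exists s' => // z z0; rewrite -sE'//.
by apply: eq_bigr => j _; rewrite inv_prod_zpow.
Qed.

Lemma exists_bound k : exists2 M : nat, (2 <= M)%N & mu k < M.+1%:R * mu 0%N.
Proof.
exists (Num.trunc (mu k / mu 0%N)).+2 => //; rewrite -ltr_pdivrMr//.
by apply: lt_le_trans (truncnS_gt _) _; rewrite ler_nat; exact: leqW (leqW (leqnn _)).
Qed.

(** All three pieces have degree - mu k: the nonlinear terms because degrees add, p by assumption,
    and the correction because R lowers the degree by one and mu l + 1 = mu k. *)
Lemma vclass_rhs (h : forall k, T k) k :
  (forall j, (j < k)%N -> tclass m (- mu j) (h j)) ->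
  vclass m (- mu k) (@rhs h k).
Proof.
move=> hP; have [M M2 kM] := exists_bound k.
have hV j : (j < k)%N ->
    vclass m (- mu j) (fun z : 'rV[R]_(nn k).+2 =>
      cplx (treal (h j) (ztrunc (nn j) z))).
  move=> jk; apply: (vclass_ztrunc (F := fun z => cplx (treal (h j) z))) => //.
    by apply: nn_le; exact: ltnW.
  by apply: P_class_vclass; apply: P_class_treal; exact: hP.
have NL : vclass m (- mu k) (fun z : 'rV[R]_(nn k).+2 =>
    cplx (nonlinear_sum mu calG (fun k => treal (h k)) z)).
  have : vclass m (- mu k) (fun z : 'rV[R]_(nn k).+2 => \sum_(2 <= d < M.+1)
      \sum_(j : {ffun 'I_d -> 'I_k} | (2 <= d)%N && (\sum_l mu (j l) == mu k))
        cplx (calG (fun l => treal (h (j l)) (ztrunc (nn (j l)) z)))).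
    apply: vclass_sum => d _; apply: vclass_sum => j /andP[d2 /eqP <-].
    rewrite -sumrN; apply: (vclass_multilinear (mu := fun l => - mu (j l))) => //.
      exact: calG_lin.
    by move=> l; exact: hV.
  move=> [s sP sE]; exists s => // z z0.
  rewrite -sE// (nonlinear_sumE mu_gt0 mu_inc calG _ z (leqnn k) kM).
  rewrite /cplx raddf_sum; apply: eq_big_nat => d /andP[d2 _].
  by rewrite raddf_sum d2.
have CH : vclass m (- mu k) (@chi_sum h k).
  apply: vclass_sum => l /andP[bT /eqP lk].
  have -> : - mu k = - mu l - 1 by rewrite -lk opprD.
  apply: (vclass_ztrunc (F := tR (tsym (h l)))) => //.
    by apply: nn_le; exact: ltnW.
  by apply: vclass_tR; [exact: bm|apply: tclass_tsym; exact: hP].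
have := vclassD (vclassD NL (P_class_vclass (p_class k))) (vclassN CH).
move=> [s sP sE]; exists s => // z z0; rewrite -sE// /rhs; congr (_ - _).
by apply/matrixP => i j; rewrite !mxE rmorphD.
Qed.

Lemma rhs_local (h h' : forall k, T k) k :
  (forall j, (j < k)%N -> h j = h' j) -> @rhs h k = @rhs h' k.
Proof.
move=> hh; apply/funext => z; rewrite /rhs /chi_sum; congr (cplx (_ + _) - _).
  have [M M2 kM] := exists_bound k.
  rewrite !(@nonlinear_sumE R n mu mu_gt0 mu_inc calG nn _ k k M z (leqnn k) kM)//.
  apply: eq_bigr => d _; apply: eq_bigr => j _.
  by congr calG; apply/funext => l; rewrite hh.
by apply: eq_bigr => l _; rewrite hh.
Qed.

Lemma exists_terms : exists h : forall k, T k, forall k,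
  tclass m (- mu k) (h k) /\
  exists s, [/\ tclass m (- mu k) s, forall z, posz z -> rhs h z = tsum s z &
    h k = tmap (@Zop (nn k)) s].
Proof.
apply: (dependent_recursion (fun=> [::]) (P := fun k => tclass m (- mu k))
  (Q := fun k h v => exists s, [/\ tclass m (- mu k) s,
    forall z, posz z -> @rhs h k z = tsum s z & v = tmap (@Zop (nn k)) s])).
  move=> k h /vclass_rhs[s sP sE]; exists (tmap (@Zop (nn k)) s).
  by split; [exact: tclass_tmap|exists s].
by move=> k h h' v hh [s [sP sE ->]]; exists s; split=> // z z0; rewrite -(rhs_local hh) sE.
Qed.

Lemma cplxB (x y : 'cV[R]_n) : cplx (x - y) = cplx x - cplx y.
Proof. by rewrite /cplx map_mxB. Qed.

Lemma is_calZ_terms (h : forall k, T k) k s :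
  tclass m (- mu k) s -> (forall z, posz z -> rhs h z = tsum s z) ->
  h k = tmap (@Zop (nn k)) s ->
  is_calZ A (@rhs h k) (fun z => cplx (treal (h k) z)).
Proof.
move=> sP sE ->; apply: is_calZ_treal sP sE _ => z _.
by rewrite /rhs chi_sum_real -cplxB map_Re_cplx.
Qed.

(** By injectivity of mu at most one index l satisfies mu l + 1 = mu k, so the sum has at most one
    term. *)
Lemma is_chi_chi_sum (h : forall k, T k) k : b ->
  is_chi mu (fun k => treal (h k)) (@chi_sum h k).
Proof.
move=> bT; split.
  move=> l lk ml; exists (tR (tsym (h l))).
    exists (tsupp (tsym (h l))), (tcoef (tsym (h l))).
    by split=> z _; rewrite ?gpoly_tsum ?tsum_tsym// calR_tsupp.
  move=> z _; rewrite /chi_sum bT/= (big_pred1 (Ordinal lk))// => l' /=.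
  apply/eqP/eqP => [|->//]; rewrite -ml => /addIr/(mu_inj mu_inc) ll'.
  exact: val_inj.
move=> nl z _; rewrite /chi_sum big_pred0// => l; apply/negbTE.
by rewrite bT/=; apply/eqP; exact: nl.
Qed.

End Construction.

(** * Estimate of the remainder *)

Section Negligible.
Variables (R : realType) (n : nat) (w : R -> 'cV[R]_n) (b : R -> R).

(** The class o(|w|) + O(b), where K may depend on eta. This fits [stability], in which eta is
    determined by A and the constant in front of b is arbitrary. *)
Definition negligible_wrt (F : R -> 'cV[R]_n) : Prop :=
  forall eta : R, 0 < eta -> exists K : R,
    \forall t \near +oo_R, `|F t| <= eta * `|w t| + K * b t.

Lemma negligible_wrt_bounded F (K : R) :
  (\forall t \near +oo_R, `|F t| <= K * b t) -> negligible_wrt F.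
Proof.
move=> HF eta eta0; exists K; near=> t.
apply: (@le_trans _ _ (K * b t)); first by near: t.
by rewrite lerDr mulr_ge0// ltW.
Unshelve. all: by end_near. Qed.

Lemma negligible_wrt0 : negligible_wrt (fun=> 0).
Proof.
by apply: (@negligible_wrt_bounded _ 0); near=> t; rewrite normr0 mul0r.
Unshelve. all: by end_near. Qed.

Lemma negligible_wrtD F F' :
  negligible_wrt F -> negligible_wrt F' -> negligible_wrt (fun t => F t + F' t).
Proof.
move=> HF HF' eta eta0; have eta2 : 0 < eta / 2 by rewrite divr_gt0.
have [K HK] := HF _ eta2; have [K' HK'] := HF' _ eta2.
exists (K + K'); near=> t; apply: le_trans (ler_normD _ _) _.
have H1 : `|F t| <= eta / 2 * `|w t| + K * b t by near: t.
have H2 : `|F' t| <= eta / 2 * `|w t| + K' * b t by near: t.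
by apply: le_trans (lerD H1 H2) _; rewrite le_eqVlt; apply/orP; left; apply/eqP; field.
Unshelve. all: by end_near. Qed.

Lemma negligible_wrtN F : negligible_wrt F -> negligible_wrt (fun t => - F t).
Proof.
move=> HF eta eta0; have [K HK] := HF _ eta0; exists K.
by near=> t; rewrite normrN; near: t.
Unshelve. all: by end_near. Qed.

Lemma negligible_wrt_eq F F' :
  (\forall t \near +oo_R, F' t = F t) -> negligible_wrt F -> negligible_wrt F'.
Proof.
move=> E HF eta eta0; have [K HK] := HF _ eta0; exists K.
near=> t; have -> : F' t = F t by near: t.
by near: t.
Unshelve. all: by end_near. Qed.

Lemma negligible_wrt_sum (I : Type) (r : seq I) (P : pred I) (F : I -> R -> 'cV[R]_n) :
  (forall i, P i -> negligible_wrt (F i)) ->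
  negligible_wrt (fun t => \sum_(i <- r | P i) F i t).
Proof.
move=> HF; elim: r => [|i r IHr].
  by rewrite (_ : (fun t => _) = fun=> 0); [exact: negligible_wrt0|
    apply/funext => t; rewrite big_nil].
case Pi : (P i).
  rewrite (_ : (fun t => _) = fun t => F i t + \sum_(i <- r | P i) F i t).
    exact: negligible_wrtD (HF _ Pi) IHr.
  by apply/funext => t; rewrite big_cons Pi.
rewrite (_ : (fun t => _) = fun t => \sum_(i <- r | P i) F i t)//.
by apply/funext => t; rewrite big_cons Pi.
Qed.

End Negligible.

(** To be read with a = A y, g = G(y), s6 the polynomial part of G(y), and s1, ..., s5 the sums over
    k of A u_k, the nonlinear terms, p_k, chi_k and R q_k. It splits the residual of w into four
    groups that are estimated separately. *)
Lemma residual_identity (R : realType) (n : nat)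
    (a g f s1 s2 s3 s4 s5 s6 : 'cV[R]_n) :
  - a + g + f - (- s1 + (s2 + s3 - s4 + s5)) =
  - (a - s1) + (g - s6 + (s6 - s2) + (f - s3) + (s4 - s5)).
Proof. by apply/matrixP => i j; rewrite !mxE; ring. Qed.

(** * The remainder of a partial sum *)

Section Asymptotics.
Variables (R : realType) (n : nat).
Hypothesis n_gt0 : (0 < n)%N.
Variable A : 'M[R]_n.
Hypothesis A_spec : forall l : R[i], eigenvalue (cplx A) l -> 0 < complex.Re l.
Local Notation C := R[i].
Local Notation Re := (@complex.Re R).
Variables (G : 'cV[R]_n -> 'cV[R]_n) (Gm : nat -> 'cV[R]_n -> 'cV[R]_n).
Variable calG : forall d : nat, ('I_d -> 'cV[R]_n) -> 'cV[R]_n.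
Hypothesis G_exp : homogeneous_expansion G Gm.
Hypothesis calG_lin : forall d, (2 <= d)%N -> multilinear_map (@calG d).
Hypothesis calG_diag : forall d, (2 <= d)%N -> forall x, Gm d x = calG (fun _ : 'I_d => x).
Variables (f y : R -> 'cV[R]_n) (T0 : R).
Hypothesis y_der : forall t : R, T0 < t -> derivable y t 1.
Hypothesis y_sol : forall t : R, T0 < t ->
  derive1 y t = - (A *m y t) + G (y t) + f t.
Hypothesis y_to0 : y t @[t --> +oo] --> (0 : 'cV[R]_n).
Variables (m : nat) (mu : nat -> R) (nn : nat -> nat) (b : bool).
Hypothesis mu_gt0 : forall k, 0 < mu k.
Hypothesis mu_inc : forall j k, (j < k)%N -> mu j < mu k.
Hypothesis mu_add : forall x x', range mu x -> range mu x' -> range mu (x + x').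
Hypothesis mu_add1 : b -> forall x, range mu x -> range mu (x + 1).
Hypothesis nn_inc : forall k, (nn k <= nn k.+1)%N.
Hypothesis nn_ge : forall k, (m <= nn k)%N.
Hypothesis bm : b = (m == 0%N).
Variable p : forall k, 'rV[R]_(nn k).+2 -> 'cV[R]_n.
Variable h : forall k, seq (term R n (nn k)).
Arguments h : clear implicits.
Hypothesis h_class : forall k, tclass m (- mu k) (h k).
Hypothesis h_rec : forall k, exists s,
  [/\ tclass m (- mu k) s,
      forall z, posz z -> rhs mu b calG p h z = tsum s z &
      h k = tmap (@Zop _ _ A (nn k)) s].

Let u k t := treal (h k) (Lhat (nn k) t).
Let r k t := map_mx Re (tR (h k) (Lhat (nn k) t)).
Let NL k t := nonlinear_sum mu calG (fun k => treal (h k)) (Lhat (nn k) t).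
Let ch k t := \sum_(l < k | b && (mu l + 1 == mu k)) r l t.

Let nn_mono j k : (j <= k)%N -> (nn j <= nn k)%N.
Proof. exact: nn_le. Qed.

Lemma u_bound k nu : - mu k < nu -> exists2 K : R, 0 <= K &
  \forall t \near +oo_R, `|u k t| <= K * lpow m nu t.
Proof.
move=> knu; have [K K0 HK] := near_tsum_bound (nn_ge k) (@h_class k) knu.
exists K => //; near=> t; apply: le_trans (norm_map_Re _) _; near: t; exact: HK.
Unshelve. all: by end_near. Qed.

Lemma r_bound k nu : - mu k < nu -> exists2 K : R, 0 <= K &
  \forall t \near +oo_R, `|r k t| <= K * (t^-1 * lpow m nu t).
Proof.
move=> knu; have [K K0 HK] := near_tR_bound (nn_ge k) (@h_class k) knu.
exists K => //; near=> t; apply: le_trans (norm_map_Re _) _; near: t; exact: HK.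
Unshelve. all: by end_near. Qed.

Lemma u_small k (e : R) : 0 < e -> \forall t \near +oo_R, `|u k t| <= e.
Proof.
move=> e0; have muk := mu_gt0 k.
have [K K0 HK] : exists2 K : R, 0 <= K &
    \forall t \near +oo_R, `|u k t| <= K * lpow m (- (mu k / 2)) t.
  by apply: u_bound; rewrite ltrN2 ltr_pdivrMr// ltr_pMr// ltr1n.
have K1 : 0 < 1 + K by rewrite ltr_pwDl.
near=> t; apply: (@le_trans _ _ (K * lpow m (- (mu k / 2)) t)); first by near: t.
apply: (@le_trans _ _ ((1 + K) * (e / (1 + K)))); last first.
  by rewrite mulrC divfK ?gt_eqF.
apply: ler_pM => //; [exact: lpow_ge0|by rewrite lerDr|].
near: t; apply: near_lpow_eps; last by rewrite divr_gt0.
by rewrite oppr_lt0 divr_gt0.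
Unshelve. all: by end_near. Qed.

(** Differentiation leaves the extra term r_k, the value of R q_k, which can be cancelled only at a
    later index, by the correction present there. *)
Lemma u_derive k : \forall t \near +oo_R, forall i,
  is_derive t (1 : R) (fun s => u k s i ord0)
    ((- (A *m u k t) + (NL k t + p (Lhat (nn k) t) - ch k t + r k t)) i ord0).
Proof.
have [s [sP sE hE]] := h_rec k.
near=> t => i.
have Ht : forall l, (l <= nn k)%N -> 0 < iterlog l t.
  move=> l lk; apply: lt_le_trans (ltr01) _; move: l lk.
  by near: t; exact: near_iterlogs_ge1.
apply: is_derive_eq (is_derive_treal (h k) i Ht) _; congr (fun_of_matrix _ i ord0).
rewrite (_ : map_mx Re (_ + _) = map_mx Re (tsum (tM ord0 (h k)) (Lhat (nn k) t)) + r k t).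
  rewrite {1}hE (tM_Zop A_spec _ sP) -hE -/(u k t) addrA; congr (_ + _ + _).
  rewrite /treal -sE; last exact: posz_Lhat.
  rewrite /rhs chi_sum_real -cplxB map_Re_cplx; congr (_ - _).
  apply: eq_bigr => l _; rewrite ztrunc_Lhat//; apply: nn_mono; exact: ltnW.
by apply/matrixP => i' j'; rewrite !mxE complex_ReD.
Unshelve. all: by end_near. Qed.

Lemma y_derive : \forall t \near +oo_R, forall i,
  is_derive t (1 : R) (fun s => y s i ord0)
    ((- (A *m y t) + G (y t) + f t) i ord0).
Proof.
near=> t => i; have Tt : T0 < t by near: t; apply: nbhs_pinfty_gt; exact: num_real.
rewrite -y_sol// derive1E derive_mx; last exact: y_der.
rewrite mxE; split=> //.
by have /derivable_mxP := y_der Tt; apply.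
Unshelve. all: by end_near. Qed.

(** Consequently no sum lies strictly between mu N and mu N.+1: one that exceeds the first reaches
    the second. *)
Lemma sum_mu_range d (j : 'I_d.+1 -> nat) : exists k, \sum_l mu (j l) = mu k.
Proof.
elim: d j => [|d IH] j; first by exists (j ord0); rewrite big_ord1.
rewrite big_ord_recr/=; have [k ->] := IH (fun l => j (widen_ord (leqnSn _) l)).
have [k' _ <-] : range mu (mu k + mu (j ord_max)).
  by apply: mu_add; [exists k|exists (j ord_max)].
by exists k'.
Qed.

Section FixedN.
Variables (N : nat) (beta : R).
Hypothesis beta_gt : mu N < beta.
Hypothesis beta_lt : beta < mu N.+1.

Let w t := y t - \sum_(k < N.+1) u k t.
Local Notation bb := (lpow m (- beta)).
Local Notation negl := (negligible_wrt w bb).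

Lemma w_small (e : R) : 0 < e -> \forall t \near +oo_R, `|w t| <= e.
Proof.
move=> e0; have e2 : 0 < e / 2 by rewrite divr_gt0.
pose e' := e / 2 / N.+1%:R.
have e'0 : 0 < e' by rewrite divr_gt0.
have Hu : \forall t \near +oo_R, forall k : 'I_N.+1, `|u k t| <= e'.
  by apply: filter_forall => k; exact: u_small.
have Hy : \forall t \near +oo_R, `|y t| <= e / 2.
  exact: (cvgr0_norm_le y y_to0).
near=> t; apply: le_trans (ler_normB _ _) _; rewrite [leRHS]splitr; apply: lerD.
  by near: t.
apply: le_trans (ler_norm_sum _ _ _) _.
have Ht : forall k : 'I_N.+1, `|u k t| <= e' by near: t.
apply: le_trans (ler_sum _ (fun k _ => Ht k)) _.
by rewrite sumr_const card_ord -[leLHS]mulr_natr /e' divfK ?pnatr_eq0.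
Unshelve. all: by end_near. Qed.

(** Grouped by l, the term r_l occurs once with a minus sign, and once with a plus sign if m = 0 and
    mu l + 1 = mu k for some k <= N; the two then cancel. Otherwise the factor 1/t makes r_l small
    enough: for m = 0 because mu l + 1 >= mu N.+1 > beta. *)
Lemma correction_negligible :
  negl (fun t => \sum_(k < N.+1) (ch k t - r k t)).
Proof.
apply: (@negligible_wrt_eq _ _ _ _ (fun t => \sum_(l < N.+1)
   (\sum_(k < N.+1 | b && ((l < k)%N && (mu l + 1 == mu k))) r l t - r l t))).
  near=> t; rewrite !sumrB; congr (_ - _).
  rewrite [RHS](exchange_big_dep xpredT)//=; apply: eq_bigr => k _.
  rewrite /ch (big_ord_widen_cond N.+1 (fun l => b && (mu l + 1 == mu k)) (fun l => r l t)).
    by apply: eq_bigl => l; rewrite -andbA; congr (_ && _); rewrite andbC.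
  exact: ltnW.
apply: negligible_wrt_sum => l _.
(* The hypothesis is void when b is false; then m > 0, r_l is O(1/t), and 1/t is eventually below
   L_m^(-beta). *)
have rbound : (b -> beta < mu l + 1) -> negl (fun t => - r l t).
  move=> bl; apply: negligible_wrtN; case: (boolP b) => bT.
    have m0 : m = 0%N by apply/eqP; rewrite -bm.
    have [|K K0 HK] := @r_bound l (1 - beta); first by rewrite ltrBrDl ltrBlDr addrC; exact: bl.
    apply: (@negligible_wrt_bounded _ _ _ _ _ K); near=> t.
    apply: (@le_trans _ _ (K * (t^-1 * lpow m (1 - beta) t))); first by near: t.
    rewrite ler_wpM2l// m0 le_eqVlt; apply/orP; left; apply/eqP.
    rewrite [RHS](_ : _ = lpow 0 (1 - beta - 1) t); last first.
      by congr lpow; rewrite addrAC subrr add0r.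
    by near: t; exact: near_inv_lpow0.
  have [|K K0 HK] := @r_bound l 0; first by rewrite oppr_lt0.
  apply: (@negligible_wrt_bounded _ _ _ _ _ K); near=> t.
  apply: (@le_trans _ _ (K * (t^-1 * lpow m 0 t))); first by near: t.
  rewrite ler_wpM2l//; near: t.
  case: (m) bm bT => [->//|m' _ _]; exact: near_inv_lpowS.
case: (boolP b) => bT; last first.
  rewrite (_ : (fun t => _) = fun t => - r l t); first by apply: rbound; rewrite (negbTE bT).
  by apply/funext => t; rewrite big_pred0 ?add0r// => k.
have [k0 _ k0E] : range mu (mu l + 1) by apply: mu_add1 => //; exists l.
have lk0 : (l < k0)%N by rewrite -(mu_lt mu_inc) k0E ltrDl.
case: (ltnP k0 N.+1) => k0N.
  rewrite (_ : (fun t => _) = fun=> 0); first exact: negligible_wrt0.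
  apply/funext => t; rewrite (big_pred1 (Ordinal k0N)) ?subrr// => k /=.
  apply/andP/eqP => [[_ /eqP]|->/=]; last by rewrite lk0 k0E.
  by rewrite -k0E => /(mu_inj mu_inc) kk; exact: val_inj.
rewrite (_ : (fun t => _) = fun t => - r l t).
  apply: rbound => _; rewrite -k0E; apply: lt_le_trans beta_lt _.
  by rewrite (mu_le mu_inc).
apply/funext => t; rewrite big_pred0 ?add0r// => k /=.
apply/negbTE; rewrite negb_and; apply/orP; right; apply/eqP.
by rewrite -k0E => /(mu_inj mu_inc) kk; move: k0N; rewrite kk leqNgt ltn_ord.
Unshelve. all: by end_near. Qed.

(* The remainder w is treated as one more summand of y, of index N + 1. *)
Let v t k := if k == N.+1 then w t else u k t.

Let sum_v t : \sum_(k < N.+2) v t k = y t.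
Proof.
rewrite big_ord_recr/= {2}/v eqxx (eq_bigr (fun k : 'I_N.+1 => u k t)).
  by rewrite /w addrC subrK.
by move=> k _; rewrite /v /= ltn_eqF.
Qed.

(** If w is among the arguments, a second argument exists and is small, which gives eta |w|. If not,
    the mu of the indices add up to at least mu N.+1 > beta, and the bounds for the u_k suffice. *)
Lemma calG_negligible d (j : {ffun 'I_d -> 'I_N.+2}) : (2 <= d)%N ->
  ~~ (\sum_l mu (j l) <= mu N) -> negl (fun t => calG (fun l => v t (j l))).
Proof.
move=> d2 jN; have [Cd Cd0 Cdb] := multilinear_bound (calG_lin d2) (Ordinal n_gt0).
have jN1 : mu N.+1 <= \sum_l mu (j l).
  case: d d2 j jN {Cdb} => // d _ j; have [k ->] := sum_mu_range (fun l => j l).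
  by rewrite !(mu_le mu_inc) -ltnNge.
case: (pselect (exists l, j l = N.+1 :> nat)) => [[l0 jl0]|nj].
  move=> eta eta0; exists 0.
  (* The bound 1 takes care of the factors beyond the two singled out below. *)
  pose rho := Num.min 1 (eta / (1 + Cd)).
  have Cd1 : 0 < 1 + Cd by rewrite ltr_pwDl.
  have rho0 : 0 < rho by rewrite lt_min ltr01 divr_gt0.
  have rho1 : rho <= 1 by rewrite ge_min lexx.
  have rho2 : Cd * rho <= eta.
    apply: (@le_trans _ _ ((1 + Cd) * rho)); first by rewrite ler_wpM2r ?(ltW rho0)// lerDr.
    by rewrite mulrC -ler_pdivlMr// ge_min lexx orbT.
  have [l1 l10] : exists l1 : 'I_d, l1 != l0.
    case: d d2 l0 {j jN Cdb jN1 jl0} => [|[|d]]// _ l0.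
    exists (if l0 == ord0 then ord_max else ord0).
    by case: (eqVneq l0 ord0) => [->//|]; rewrite eq_sym.
  have Hv : \forall t \near +oo_R, forall l, `|v t (j l)| <= rho.
    apply: filter_forall => l; rewrite /v; case: eqP => _; first exact: w_small.
    exact: u_small.
  near=> t; rewrite mul0r addr0; apply: le_trans (Cdb _) _.
  have Ht : forall l, `|v t (j l)| <= rho by near: t.
  rewrite (bigD1 l0)//= (bigD1 l1)//= {1}/v jl0 eqxx.
  apply: (@le_trans _ _ (Cd * (`|w t| * rho))).
    rewrite ler_wpM2l// ler_wpM2l// -[leRHS]mulr1; apply: ler_pM => //.
      by apply: prodr_ge0.
    apply: prodr_ile1 => l _; rewrite normr_ge0/=; exact: le_trans (Ht l) rho1.
  by rewrite mulrCA mulrC ler_wpM2r.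
have d0 : 0 < d%:R :> R by rewrite ltr0n (leq_trans _ d2).
(* The gap above beta is distributed over the d factors, so that their exponents add up to exactly -
   beta. *)
pose e := (\sum_l mu (j l) - beta) / d%:R.
have e0 : 0 < e.
  by rewrite divr_gt0// subr_gt0; exact: lt_le_trans beta_lt jN1.
have H l : {K : R | 0 <= K & \forall t \near +oo_R,
    `|u (j l) t| <= K * lpow m (- mu (j l) + e) t}.
  by apply: cid2; apply: u_bound; rewrite ltrDl.
have HK : \forall t \near +oo_R, forall l,
    `|u (j l) t| <= s2val (H l) * lpow m (- mu (j l) + e) t.
  by apply: filter_forall => l; exact: s2valP' (H l).
apply: (@negligible_wrt_bounded _ _ _ _ _ (Cd * \prod_l s2val (H l))).
near=> t; apply: le_trans (Cdb _) _; rewrite -mulrA ler_wpM2l//.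
have Ht : forall l, `|u (j l) t| <= s2val (H l) * lpow m (- mu (j l) + e) t by near: t.
have -> : bb t = \prod_l lpow m (- mu (j l) + e) t.
  rewrite /lpow -expR_sum -mulr_suml big_split/= sumr_const card_ord sumrN.
  by rewrite -[e *+ d]mulr_natr /e divfK ?gt_eqF// addKr.
rewrite -big_split/=; apply: ler_prod => l _; rewrite normr_ge0/=.
by rewrite /v; case: eqP => // jl; case: nj; exists l.
Unshelve. all: by end_near. Qed.

(** The weight mu N.+1 given to w is bookkeeping and no claim about its size: it puts every tuple
    involving w outside the range of sums at most mu N. The tuples inside that range are the terms
    of the NL k with k <= N, each belonging to exactly one k. *)
Lemma polynomial_negligible (M : nat) : mu N < M.+1%:R * mu 0%N ->
  negl (fun t => \sum_(2 <= d < M.+1) Gm d (y t) - \sum_(k < N.+1) NL k t).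
Proof.
move=> NM.
apply: (@negligible_wrt_eq _ _ _ _ (fun t => \sum_(2 <= d < M.+1)
   \sum_(j : {ffun 'I_d -> 'I_N.+2} | (2 <= d)%N && ~~ (\sum_l mu (j l) <= mu N))
      calG (fun l => v t (j l)))); last first.
  apply: negligible_wrt_sum => d _; apply: negligible_wrt_sum => j /andP[].
  exact: calG_negligible.
near=> t.
have NLE (k : 'I_N.+1) : NL k t = \sum_(2 <= d < M.+1)
    \sum_(j : {ffun 'I_d -> 'I_N.+2} | \sum_l mu (j l) == mu k)
      calG (fun l => v t (j l)).
  have kN : mu k <= mu N by rewrite (mu_le mu_inc) -ltnS.
  rewrite /NL (@nonlinear_sumE _ _ _ mu_gt0 mu_inc calG nn _ k N.+2 M)//; last 2 first.
  - exact: leqW (ltnW _).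
  - exact: le_lt_trans NM.
  apply: eq_big_nat => d /andP[d2 _]; apply: eq_bigr => j /eqP jk.
  congr calG; apply/funext => l.
  have jlk : (j l < k)%N.
    by apply: (@index_lt_of_sum _ _ mu_gt0 mu_inc d (fun l => j l) k l d2); rewrite jk.
  rewrite ztrunc_Lhat; last by apply: nn_mono; exact: ltnW.
  by rewrite /v ltn_eqF// (ltn_trans jlk)// (ltn_trans (ltn_ord k)).
under [X in _ - X]eq_bigr do rewrite NLE.
rewrite exchange_big/= -sumrB; apply: eq_big_nat => d /andP[d2 _].
rewrite calG_diag// -sum_v (multilinear_sum (calG_lin d2) ord0) d2/=.
rewrite (bigID (fun j : {ffun 'I_d -> 'I_N.+2} => \sum_l mu (j l) <= mu N))/=.
rewrite addrAC (_ : _ - _ = 0) ?add0r//; apply/eqP; rewrite subr_eq0; apply/eqP.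
rewrite [RHS](exchange_big_dep
  (fun j : {ffun 'I_d -> 'I_N.+2} => \sum_l mu (j l) <= mu N))/=; last first.
  by move=> k j _ /eqP ->; rewrite (mu_le mu_inc) -ltnS.
apply: eq_bigr => j jN.
have [k0 k0E] : exists k, \sum_l mu (j l) = mu k.
  by case: d d2 j jN => // d _ j _; exact: (sum_mu_range (fun l => j l)).
have k0N : (k0 < N.+1)%N by rewrite ltnS -(mu_le mu_inc) -k0E.
rewrite (big_pred1 (Ordinal k0N))// => k /=; rewrite k0E.
by apply/eqP/eqP => [/(mu_inj mu_inc) kk|->//]; apply: val_inj.
Unshelve. all: by end_near. Qed.

(** The remainder is O(|y|^M). Where |w| <= |u_N|, one has |y| <= 2 |u_N|, and M factors O(L_m^(-
    mu_0 / 2)) reach L_m^(-beta). Elsewhere |y| <= 2 |w|, and all but one of the M factors |w| are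
    small. *)
Lemma remainder_negligible (M : nat) : (2 <= M)%N -> beta <= M%:R * (mu 0%N / 2) ->
  negl (fun t => G (y t) - \sum_(2 <= d < M.+1) Gm d (y t)).
Proof.
move=> M2 bM; have [_ /(_ M M2)[delta delta0 [r0 [C0 [r00 C00 HG]]]]] := G_exp.
have mu0 := mu_gt0 0%N.
have H (k : 'I_N.+1) : {K : R | 0 <= K & \forall t \near +oo_R,
    `|u k t| <= K * lpow m (- (mu 0%N / 2)) t}.
  apply: cid2; apply: u_bound; have : mu 0%N <= mu k by rewrite (mu_le mu_inc).
  by lra.
have HK : \forall t \near +oo_R, forall k : 'I_N.+1,
    `|u k t| <= s2val (H k) * lpow m (- (mu 0%N / 2)) t.
  by apply: filter_forall => k; exact: s2valP' (H k).
pose K := \sum_k s2val (H k).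
have K0 : 0 <= K by apply: sumr_ge0 => k _; exact: s2valP (H k).
have n1 : 1 <= n%:R :> R by rewrite ler1n.
have n0 : 0 < n%:R :> R by rewrite ltr0n.
move=> eta eta0; exists (C0 * (n%:R * (2 * K)) ^+ M).
pose c : R := C0 * (n%:R * 2) ^+ M.
have c0 : 0 < c by rewrite mulr_gt0// exprn_gt0// mulr_gt0.
pose rho := Num.min 1 (eta / c).
have rho0 : 0 < rho by rewrite lt_min ltr01 divr_gt0.
(* Makes the Euclidean norm of y less than r0 and at most 1, so that the power M + delta can be
   lowered to M. *)
pose sig := Num.min (1 / n%:R) (r0 / 2 / n%:R).
have sig0 : 0 < sig by rewrite lt_min !divr_gt0.
have Hy : \forall t \near +oo_R, `|y t| <= sig by exact: (cvgr0_norm_le y y_to0).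
near=> t.
have ysig : `|y t| <= sig by near: t.
have Hu : `|\sum_(k < N.+1) u k t| <= K * lpow m (- (mu 0%N / 2)) t.
  apply: le_trans (ler_norm_sum _ _ _) _; rewrite mulr_suml; apply: ler_sum => k _.
  by move: k; near: t.
have wrho : `|w t| <= rho by near: t; exact: w_small.
have lM : lpow m (- (mu 0%N / 2)) t ^+ M <= bb t.
  rewrite /lpow -expRM_natl ler_expR mulrA ler_wpM2r//.
    by apply: ltW; near: t; exact: near_iterlog_gt0.
  by rewrite mulrN lerN2.
have ey : enorm (y t) <= n%:R * `|y t| := enorm_le_norm _.
have ey1 : enorm (y t) <= 1.
  apply: le_trans ey _; rewrite mulrC -ler_pdivlMr//; apply: le_trans ysig _.
  by rewrite ge_min lexx.
have eyr : enorm (y t) < r0.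
  apply: (@le_lt_trans _ _ (r0 / 2)); last by rewrite ltr_pdivrMr// ltr_pMr// ltr1n.
  apply: le_trans ey _; rewrite mulrC -ler_pdivlMr//; apply: le_trans ysig _.
  by rewrite ge_min lexx orbT.
have ey0 : 0 <= enorm (y t) by exact: sqrtr_ge0.
apply: le_trans (norm_le_enorm _) _; apply: le_trans (HG _ eyr) _.
have powle : enorm (y t) `^ (M%:R + delta) <= (n%:R * `|y t|) ^+ M.
  apply: (@le_trans _ _ (enorm (y t) ^+ M)); last by rewrite lerXn2r ?nnegrE ?mulr_ge0.
  have [->|yn0] := eqVneq (enorm (y t)) 0.
    rewrite powR0 ?exprn_ge0// gt_eqF// ltr_pwDr//.
  rewrite -powR_mulrn//; apply: ger_powR; last by rewrite lerDl ltW.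
  by rewrite lt_neqAle eq_sym yn0 ey0.
apply: le_trans (ler_wpM2l (ltW C00) powle) _.
have yuw : `|y t| <= `|\sum_(k < N.+1) u k t| + `|w t|.
  by apply: le_trans (ler_normD _ _); rewrite /w addrC subrK.
set U := `|\sum_(k < N.+1) u k t| in Hu yuw *.
have U0 : 0 <= U by exact: normr_ge0.
case: (leP `|w t| U) => wU.
  apply: (@le_trans _ _ (C0 * (n%:R * (2 * K)) ^+ M * bb t)); last first.
    by rewrite lerDr mulr_ge0// ltW.
  rewrite -mulrA ler_wpM2l ?(ltW C00)//.
  apply: (@le_trans _ _ ((n%:R * (2 * K)) ^+ M * lpow m (- (mu 0%N / 2)) t ^+ M)).
    rewrite -exprMn lerXn2r ?nnegrE ?mulr_ge0 ?lpow_ge0// -mulrA ler_wpM2l//.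
    by apply: le_trans yuw _; lra.
  by rewrite ler_wpM2l// exprn_ge0// !mulr_ge0.
apply: (@le_trans _ _ (eta * `|w t|)); last first.
  by rewrite lerDl !mulr_ge0 ?exprn_ge0 ?mulr_ge0 ?lpow_ge0// ltW.
apply: (@le_trans _ _ (c * `|w t| ^+ M)).
  rewrite /c -mulrA ler_wpM2l ?(ltW C00)// -exprMn lerXn2r ?nnegrE ?mulr_ge0//.
  by rewrite -mulrA ler_wpM2l//; lra.
apply: (@le_trans _ _ (c * (rho * `|w t|))).
  rewrite ler_wpM2l ?(ltW c0)//; case: (M) M2 => [|[|M']]// _.
  rewrite exprSr ler_wpM2r// exprS -[leRHS]mulr1 ler_pM// ?exprn_ge0//.
  rewrite exprn_ile1//; apply: le_trans wrho _; by rewrite ge_min lexx.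
rewrite mulrA ler_wpM2r// mulrC -ler_pdivlMr// ge_min lexx orbT//.
Unshelve. all: by end_near. Qed.

Lemma partial_sum_bound (nu : R) : beta <= nu ->
  bigO_at_infty (fun t => f t - \sum_(k < N.+1) p (Lhat (nn k) t))
    (fun t => iterlog m t `^ (- nu)) ->
  bigO_at_infty w (fun t => iterlog m t `^ (- beta)).
Proof.
move=> bnu [T [K [T_gt0 K0 HfK]]].
have f_negl : negl (fun t => f t - \sum_(k < N.+1) p (Lhat (nn k) t)).
  apply: (@negligible_wrt_bounded _ _ _ _ _ K); near=> t.
  apply: le_trans (norm_le_enorm _) _.
  apply: le_trans (HfK t _) _; first by near: t; apply: nbhs_pinfty_ge; exact: num_real.
  rewrite ler_wpM2l ?(ltW K0)//.
  have -> : iterlog m t `^ (- nu) = lpow m (- nu) t by near: t; exact: near_powR_lpow.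
  by near: t; apply: near_lpow_le; rewrite lerN2.
(* Serves two thresholds: beta <= M mu_0 / 2 for the remainder of G, and mu_N < (M + 1) mu_0 for the
   degrees occurring in the recursion. *)
pose M := (Num.trunc (beta / (mu 0%N / 2))).+2.
have mu0 := mu_gt0 0%N.
have b0 : 0 < beta by apply: lt_trans beta_gt.
have MB : beta <= M%:R * (mu 0%N / 2).
  rewrite -ler_pdivrMr ?divr_gt0//; apply: ltW; apply: lt_le_trans (truncnS_gt _) _.
  by rewrite ler_nat.
have MN : mu N < M.+1%:R * mu 0%N.
  apply: lt_le_trans beta_gt _; apply: le_trans MB _.
  apply: ler_pM => //; [by rewrite divr_ge0// ltW|by rewrite ler_nat|].
  by rewrite ler_pdivrMr// ler_peMr ?(ltW mu0)// ler1n.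
pose hh t := (G (y t) - \sum_(2 <= d < M.+1) Gm d (y t)) +
  (\sum_(2 <= d < M.+1) Gm d (y t) - \sum_(k < N.+1) NL k t) +
  (f t - \sum_(k < N.+1) p (Lhat (nn k) t)) +
  \sum_(k < N.+1) (ch k t - r k t).
have hh_negl : negl hh.
  apply: negligible_wrtD; last exact: correction_negligible.
  apply: negligible_wrtD => //; apply: negligible_wrtD; last exact: polynomial_negligible.
  exact: remainder_negligible.
(* Here eta is fixed from A alone, before the constant K' of [hh] is requested for it. *)
have [eta eta0 stab] := stability n_gt0 A_spec.
have [K' HK'] := hh_negl _ eta0.
have [D HD] : exists D, \forall t \near +oo_R, `|w t| <= D * bb t.
  apply: (stab w hh bb (fun t => - beta * dlog m.+1 t * bb t) K') => //.
  - have Hu : \forall t \near +oo_R, forall k : 'I_N.+1, forall i,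
        is_derive t (1 : R) (fun s => u k s i ord0)
        ((- (A *m u k t) + (NL k t + p (Lhat (nn k) t) - ch k t + r k t)) i ord0).
      by apply: filter_forall => k; exact: u_derive.
    near=> t => i.
    have Hyt : is_derive t (1 : R) (fun s => y s i ord0)
        ((- (A *m y t) + G (y t) + f t) i ord0).
      by move: i; near: t; exact: y_derive.
    have Hut : forall (k : 'I_N.+1) i,
        is_derive t (1 : R) (fun s => u k s i ord0)
        ((- (A *m u k t) + (NL k t + p (Lhat (nn k) t) - ch k t + r k t)) i ord0).
      by near: t.
    rewrite (_ : (fun s => w s i ord0) = (fun s => y s i ord0) -
        (fun s => \sum_(k < N.+1) u k s i ord0)); last first.
      by apply/funext => s; rewrite /w !mxE summxE.
    apply: is_derive_eq (is_deriveB Hyt (is_derive_sum_fun (fun k => Hut k i))) _.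
    rewrite -summxE -[X in X = _]/(_ i ord0 - _ i ord0).
    rewrite (_ : forall B D : 'cV[R]_n, B i ord0 - D i ord0 = (B - D) i ord0); last first.
      by move=> B B'; rewrite !mxE.
    congr (fun_of_matrix _ i ord0); rewrite /hh /w mulmxBr mulmx_sumr !big_split/= !sumrN.
    exact: residual_identity.
  - near=> t; apply: is_derive_lpow => l lm; apply: lt_le_trans (ltr01) _.
    by move: l lm; near: t; exact: near_iterlogs_ge1.
  - by near=> t; exact: lpow_gt0.
  - near=> t; rewrite !mulNr lerN2 ler_wpM2r ?lpow_ge0//.
    have /andP[_ dle] : 0 <= dlog m.+1 t <= eta / beta.
      by near: t; apply: near_dlog; rewrite divr_gt0.
    by rewrite mulrC -ler_pdivlMr.
near +oo_R => T1.
exists (Num.max 1 T1), (n%:R * `|D| + 1); split.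
- by rewrite lt_max ltr01.
- by rewrite ltr_wpDl// mulr_ge0.
- move=> t; rewrite ge_max => /andP[_ T1t].
  have [wD ->] : `|w t| <= D * bb t /\ iterlog m t `^ (- beta) = bb t.
    move: t T1t; near: T1.
    have [T2 [_ HT2]] : \forall t \near +oo_R,
        `|w t| <= D * bb t /\ iterlog m t `^ (- beta) = bb t.
      by near=> t; split; near: t => //; exact: near_powR_lpow.
    exists T2; split; first exact: num_real.
    by move=> T3 T23 t T3t; apply: HT2; exact: lt_le_trans T3t.
  apply: le_trans (enorm_le_norm _) _.
  apply: (@le_trans _ _ (n%:R * (`|D| * bb t))).
    rewrite ler_wpM2l//; apply: le_trans wD _.
    by rewrite ler_wpM2r ?lpow_ge0// ler_norm.
  by rewrite mulrA ler_wpM2r ?lpow_ge0// lerDl.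
Unshelve. all: by end_near. Qed.

End FixedN.

End Asymptotics.

(** * Assembly of the two cases *)

Lemma bigO_at_infty_eq (R : realType) (n : nat) (u u' : R -> 'cV[R]_n) (g : R -> R) :
  (\forall t \near +oo_R, u' t = u t) -> bigO_at_infty u g -> bigO_at_infty u' g.
Proof.
move=> [T [_ HT]] [T' [C [T'0 C0 HC]]].
exists (Num.max T' (T + 1)), C; split=> //; first by rewrite lt_max T'0.
move=> t; rewrite ge_max => /andP[T't Tt]; rewrite HT ?HC//.
by apply: lt_le_trans Tt; rewrite ltrDl.
Qed.

(** Common core of both cases: b is true exactly for m = 0 and switches the corrections chi_k on. *)
Lemma expansion_of_solution (R : realType) (n : nat) (A : 'M[R]_n)
  (G : 'cV[R]_n -> 'cV[R]_n) (Gm : nat -> 'cV[R]_n -> 'cV[R]_n)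
  (calG : forall d : nat, ('I_d -> 'cV[R]_n) -> 'cV[R]_n)
  (f y : R -> 'cV[R]_n) (T0 : R) (mu : nat -> R) (m : nat) (nn : nat -> nat)
  (b : bool) (fk : nat -> R -> 'cV[R]_n)
  (p : forall k, 'rV[R]_(nn k).+2 -> 'cV[R]_n) :
  (0 < n)%N -> (forall l : R[i], eigenvalue (cplx A) l -> 0 < complex.Re l) ->
  homogeneous_expansion G Gm ->
  (forall d, (2 <= d)%N -> multilinear_map (calG d)) ->
  (forall d, (2 <= d)%N -> forall x, Gm d x = calG d (fun=> x)) ->
  (forall t : R, T0 < t -> derivable y t 1) ->
  (forall t : R, T0 < t -> derive1 y t = - (A *m y t) + G (y t) + f t) ->
  y t @[t --> +oo] --> (0 : 'cV[R]_n) ->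
  (forall k, 0 < mu k) -> (forall j k, (j < k)%N -> mu j < mu k) ->
  (forall x x', range mu x -> range mu x' -> range mu (x + x')) ->
  (b -> forall x, range mu x -> range mu (x + 1)) ->
  (forall k, (nn k <= nn k.+1)%N) -> (forall k, (m <= nn k)%N) ->
  b = (m == 0%N) ->
  asymptotic_expansion m mu nn fk f ->
  (forall k, P_class m (- mu k) (p k)) ->
  (forall k t, iterexp (nn k) 0 < t -> fk k t = p k (Lhat (nn k) t)) ->
  exists h : forall k, seq (term R n (nn k)),
    [/\ forall k, P_class m (- mu k) (treal (h k)),
        forall k, is_calZ A (@rhs _ _ mu nn b calG p h k)
          (fun z => cplx (treal (h k) z)) &
        asymptotic_expansion m mu nn (fun k t => treal (h k) (Lhat (nn k) t)) y].
Proof.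
move=> n_gt0 A_spec G_exp calG_lin calG_diag y_der y_sol y_to0 mu_gt0 mu_inc
  mu_add mu_add1 nn_inc nn_ge bm [_ f_exp] p_class fkE.
have bm0 : b -> m = 0%N by rewrite bm => /eqP.
have [h hP] := exists_terms A n_gt0 calG_lin mu_gt0 mu_inc nn_inc nn_ge bm0 p_class.
have h_class k : tclass m (- mu k) (h k) by case: (hP k).
have h_rec k := (hP k).2.
have q_class k : P_class m (- mu k) (treal (h k)) by exact: P_class_treal.
exists h; split=> //.
  by move=> k; have [s [sP sE hE]] := h_rec k; exact: is_calZ_terms sP sE hE.
split=> [k|N]; first by exists (treal (h k)).
have [nu nuN HO] := f_exp N; have muN := mu_inc _ _ (ltnSn N).
have [beta beta_gt [beta_lt bnu]] :
    exists2 beta, mu N < beta & beta < mu N.+1 /\ beta <= nu.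
  (* Below mu N.+1 to keep the gap, and at most nu because f is controlled only up to
     O(L_m^(-nu)). *)
  exists (Num.min ((mu N + mu N.+1) / 2) nu).
    by rewrite lt_min nuN andbT midf_lt.
  by rewrite gt_min ge_min midf_lt// lexx orbT.
exists beta => //.
apply: (partial_sum_bound n_gt0 A_spec G_exp calG_lin calG_diag y_der y_sol y_to0
  mu_gt0 mu_inc mu_add mu_add1 nn_inc nn_ge bm h_class h_rec beta_gt beta_lt bnu).
apply: bigO_at_infty_eq HO.
have H : \forall t \near +oo_R, forall k : 'I_N.+1, iterexp (nn k) 0 < t.
  by apply: filter_forall => k; apply: nbhs_pinfty_gt; exact: num_real.
near=> t; congr (_ - _); apply: eq_bigr => k _; apply/esym/fkE.
by move: k; near: t.
Unshelve. all: by end_near. Qed.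

Theorem theorem10p8 (R : realType) (n : nat) (n_gt0 : (0 < n)%N)
  (A : 'M[R]_n)
  (A_spec : forall l : R[i], eigenvalue (cplx A) l -> 0 < complex.Re l)
  (G : 'cV[R]_n -> 'cV[R]_n) (Gm : nat -> 'cV[R]_n -> 'cV[R]_n)
  (calG : forall m : nat, ('I_m -> 'cV[R]_n) -> 'cV[R]_n)
  (G_lip : locally_lipschitz G)
  (G_exp : homogeneous_expansion G Gm)
  (calG_lin : forall m, (2 <= m)%N -> multilinear_map (calG m))
  (calG_diag : forall m, (2 <= m)%N -> forall x, Gm m x = calG m (fun=> x))
  (f : R -> 'cV[R]_n) (Tf : R) (Tf_ge0 : 0 <= Tf)
  (f_cont : {within [set t : R | 0 < t /\ Tf <= t], continuous f})
  (T0 : R) (T0_ge0 : 0 <= T0) (y : R -> 'cV[R]_n)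
  (y_der : forall t : R, T0 < t -> derivable y t 1)
  (y_C1 : {within [set t : R | T0 < t], continuous (derive1 y)})
  (y_sol : forall t : R, T0 < t -> derive1 y t = - (A *m y t) + G (y t) + f t)
  (y_to0 : y t @[t --> +oo] --> (0 : 'cV[R]_n))
  (mu : nat -> R) (mu_gt0 : forall k, 0 < mu k)
  (mu_inc : forall j k, (j < k)%N -> mu j < mu k)
  (mu_div : mu k @[k --> \oo] --> +oo)
  (mu_add : forall x x', range mu x -> range mu x' -> range mu (x + x')) :
  ((forall x, range mu x -> range mu (x + 1)) ->
   forall (nn : nat -> nat) (fk : nat -> R -> 'cV[R]_n),
     (forall k, (nn k <= nn k.+1)%N) ->
     asymptotic_expansion 0 mu nn fk f ->
     (exists yk : nat -> R -> 'cV[R]_n,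
        asymptotic_expansion 0 mu nn yk y) /\
     (forall p : forall k, 'rV[R]_(nn k).+2 -> 'cV[R]_n,
        (forall k, P_class 0 (- mu k) (p k)) ->
        (forall k t, iterexp (nn k) 0 < t -> fk k t = p k (Lhat (nn k) t)) ->
        exists q : forall k, 'rV[R]_(nn k).+2 -> 'cV[R]_n,
          [/\ forall k, P_class 0 (- mu k) (q k),
              forall k,
                exists2 chi : 'rV[R]_(nn k).+2 -> 'cV[R[i]]_n,
                  is_chi mu q chi &
                  is_calZ A
                    (fun z => cplx (nonlinear_sum mu calG q z + p k z) - chi z)
                    (fun z => cplx (q k z)) &
              asymptotic_expansion 0 mu nn
                (fun k t => q k (Lhat (nn k) t)) y]))
  /\
  (forall ms : nat, (1 <= ms)%N ->
   forall (nn : nat -> nat) (fk : nat -> R -> 'cV[R]_n),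
     (forall k, (nn k <= nn k.+1)%N) ->
     (forall k, (ms <= nn k)%N) ->
     asymptotic_expansion ms mu nn fk f ->
     (exists yk : nat -> R -> 'cV[R]_n,
        asymptotic_expansion ms mu nn yk y) /\
     (forall p : forall k, 'rV[R]_(nn k).+2 -> 'cV[R]_n,
        (forall k, P_class ms (- mu k) (p k)) ->
        (forall k t, iterexp (nn k) 0 < t -> fk k t = p k (Lhat (nn k) t)) ->
        exists q : forall k, 'rV[R]_(nn k).+2 -> 'cV[R]_n,
          [/\ forall k, P_class ms (- mu k) (q k),
              forall k,
                is_calZ A
                  (fun z => cplx (nonlinear_sum mu calG q z + p k z))
                  (fun z => cplx (q k z)) &
              asymptotic_expansion ms mu nn
                (fun k t => q k (Lhat (nn k) t)) y])).
Proof.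
split.
  move=> mu_add1 nn fk nn_inc f_exp.
  have main (p : forall k, 'rV[R]_(nn k).+2 -> 'cV[R]_n) :=
    @expansion_of_solution R n A G Gm calG f y T0 mu 0 nn true fk p n_gt0 A_spec
      G_exp calG_lin calG_diag y_der y_sol y_to0 mu_gt0 mu_inc mu_add
      (fun=> mu_add1) nn_inc (fun=> isT) erefl f_exp.
  split.
    (* For bare existence the p_k are chosen from the membership of the f_k in their classes. *)
    have pP k := cid2 (f_exp.1 k).
    have [h [_ _ y_exp]] :=
      main _ (fun k => s2valP (pP k)) (fun k => s2valP' (pP k)).
    by exists (fun k t => treal (h k) (Lhat (nn k) t)).
  move=> p p_class fkE; have [h [q_class q_rec y_exp]] := main p p_class fkE.
  exists (fun k => treal (h k)); split=> // k.
  exists (@chi_sum _ _ mu nn true h k); first exact: is_chi_chi_sum.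
  exact: q_rec.
move=> ms ms1 nn fk nn_inc nn_ge f_exp.
have ms0 : false = (ms == 0%N) by case: (ms) ms1.
have main (p : forall k, 'rV[R]_(nn k).+2 -> 'cV[R]_n) :=
  @expansion_of_solution R n A G Gm calG f y T0 mu ms nn false fk p n_gt0 A_spec
    G_exp calG_lin calG_diag y_der y_sol y_to0 mu_gt0 mu_inc mu_add
    (fun e => False_ind _ (Bool.diff_false_true e)) nn_inc nn_ge ms0 f_exp.
split.
  have pP k := cid2 (f_exp.1 k).
  have [h [_ _ y_exp]] :=
    main _ (fun k => s2valP (pP k)) (fun k => s2valP' (pP k)).
  by exists (fun k t => treal (h k) (Lhat (nn k) t)).
move=> p p_class fkE; have [h [q_class q_rec y_exp]] := main p p_class fkE.
exists (fun k => treal (h k)); split=> // k.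
rewrite (_ : (fun z => _) = @rhs _ _ mu nn false calG p h k)//.
by apply/funext => z; rewrite /rhs /chi_sum big_pred0 ?subr0.
Qed.
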